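(* Let $m\ge2$ and let $\mathcal{H}\in\mathcal{P}(\mathcal{H})$ be a connected tricyclic Type I ($m$-uniform linear) hypergraph with $k$ edges such that $\mathcal{H}\ne T_1C(k-5,0,0,0)$. Then $\lambda_1(\mathcal{H})\le\lambda_1(T_1C(k-6,0,1,0))$, and equality holds only when $\mathcal{H}=T_1C(k-6,0,1,0)$.
   Context: A hypergraph has a finite vertex set and an edge set of non-empty subsets of the vertex set; it is $m$-uniform if all edges have cardinality $m$, and linear if two distinct edges share at most one vertex. The adjacency matrix of a linear $m$-uniform hypergraph has $(i,j)$ entry $\frac{1}{m-1}$ if $i\ne j$ lie in a common edge, and $0$ otherwise; $\lambda_1$ denotes the spectral radius of this matrix. The $m$-th power hypergraph of a graph $G(V,E)$ is the $m$-uniform hypergraph obtained by adding to each edge $e\in E$ $m-2$ new vertices $v_{e,1},\dots,v_{e,m-2}$ (distinct for distinct edges). $\mathcal{P}(\mathcal{H})$ denotes the set of $m$-th power hypergraphs of graphs (a fixed notation for the set, not depending on the particular hypergraph $\mathcal{H}$). A loose cycle of length $l\ge3$, $v_1e_1v_2e_2\dots v_le_lv_1$, is the $m$-uniform hypergraph with edges $e_1,\dots,e_l$ in which $e_{i-1}\cap e_i=\{v_i\}$ (indices mod $l$, the $v_i$ distinct) and non-consecutive edges are disjoint. A linear hypergraph is tricyclic ($3$-cyclic) if it contains exactly three loose cycles. An $m$-uniform $3$-cyclic linear hypergraph with $n$ vertices and $k$ edges is of Type I if $n=k(m-1)-1$. Attaching a pendant edge at a vertex $v$ means adding a new edge consisting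 of $v$ and $m-1$ new vertices. $T_1C(l_1,l_2,l_3,l_4)$ is the hypergraph consisting of the five edges $e_1,\dots,e_5$ forming the three loose cycles $v_1e_1v_2e_2v_3e_3v_1$, $v_1e_3v_3e_4v_4e_5v_1$ and $v_1e_1v_2e_2v_3e_4v_4e_5v_1$, together with $l_1,l_2,l_3,l_4$ pendant edges attached at $v_1,v_2,v_3,v_4$, respectively. Equality of hypergraphs means isomorphism. *)

(* Defs.v *)
From mathcomp Require Import all_boot all_order all_algebra.

Set Implicit Arguments.
Unset Strict Implicit.
Unset Printing Implicit Defensive.

Import Order.TTheory GRing.Theory Num.Theory.

Record hypergraph := Hypergraph {
  vertex : finType;
  edges : {set {set vertex}};
  edges_neq0 : set0 \notin edges }.

Definition uniform (m : nat) (H : hypergraph) : Prop :=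
  forall e, e \in edges H -> #|e| = m.

Definition linear_hypergraph (H : hypergraph) : Prop :=
  forall e f, e \in edges H -> f \in edges H -> e != f -> #|e :&: f| <= 1.

Definition isomorphic (H1 H2 : hypergraph) : Prop :=
  exists f : vertex H1 -> vertex H2,
    bijective f /\ edges H2 = [set f @: (e : {set vertex H1}) | e in edges H1].

Definition adjacent (H : hypergraph) : rel (vertex H) :=
  fun x y => (x != y) && [exists e in edges H, (x \in e) && (y \in e)].

Definition connected_hypergraph (H : hypergraph) : Prop :=
  forall x y : vertex H, connect (@adjacent H) x y.

(* The cyclic sequence v_0 e_0 v_1 e_1 ... v_(l-1) e_(l-1) v_0; ordS and
   ord_pred are the successor and predecessor modulo l on 'I_l. *)
Definition loose_cycle (V : finType) (l : nat)
    (v : 'I_l -> V) (e : 'I_l -> {set V}) : Prop :=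
  [/\ 3 <= l,
      injective v,
      forall i, e (ord_pred i) :&: e i = [set v i]
    & forall i j, i != j -> j != ordS i -> i != ordS j ->
        [disjoint e i & e j] ].

(* A loose cycle contained in H is a subhypergraph of H, hence is recorded by
   its edge set: rotations and reversals of the cyclic sequence are not
   distinguished. *)
Definition contains_loose_cycle (H : hypergraph)
    (F : {set {set vertex H}}) : Prop :=
  F \subset edges H /\
  exists (l : nat) (v : 'I_l -> vertex H) (e : 'I_l -> {set vertex H}),
    loose_cycle v e /\ F = [set e i | i : 'I_l].

Definition num_loose_cycles (H : hypergraph) (c : nat) : Prop :=
  exists S : {set {set {set vertex H}}},
    #|S| = c /\ forall F, F \in S <-> contains_loose_cycle F.

Definition tricyclic (H : hypergraph) : Prop := num_loose_cycles H 3.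

(* n = k(m-1) - 1, written without truncated subtraction. *)
Definition typeI (m : nat) (H : hypergraph) : Prop :=
  #|vertex H| + 1 = #|edges H| * (m - 1).

Section Power.
Variables (m : nat) (G : hypergraph).

(* The new vertices v_{e,1}, ..., v_{e,m-2} are the inr (e, j). *)
Definition power_vertex : finType :=
  (vertex G + {e : {set vertex G} | e \in edges G} * 'I_(m - 2))%type.

Definition power_edge (e : {e : {set vertex G} | e \in edges G}) :
    {set power_vertex} :=
  (inl @: val e) :|: [set inr (e, j) | j : 'I_(m - 2)].

Lemma power_edges_neq0 : set0 \notin [set power_edge e | e in predT].
Proof.
apply/imsetP => -[[e eG] _] /esym/setP E0.
case: (set_0Vmem e) => [e0|[x xe]].
  by move: (edges_neq0 G); rewrite -e0 eG.
by move: (E0 (inl x)); rewrite !inE (imset_f _ xe).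
Qed.

Definition power : hypergraph := Hypergraph power_edges_neq0.
End Power.

(* A (simple) graph is a 2-uniform hypergraph. *)
Definition is_power_hypergraph (m : nat) (H : hypergraph) : Prop :=
  exists G : hypergraph, uniform 2 G /\ isomorphic H (power m G).

Section Pendant.
Variables (m : nat) (H : hypergraph) (l : vertex H -> nat).

(* l v pendant edges are attached at each vertex v; the pendant edge p consists
   of inl (tag p) and of the m-1 new vertices inr (p, j). *)
Definition pendant_vertex : finType :=
  (vertex H + {v : vertex H & 'I_(l v)} * 'I_(m - 1))%type.

Definition pendant_edge (p : {v : vertex H & 'I_(l v)}) :
    {set pendant_vertex} :=
  inl (tag p) |: [set inr (p, j) | j : 'I_(m - 1)].

Definition pendant_edges : {set {set pendant_vertex}} :=
  [set inl @: (e : {set vertex H}) | e in edges H] :|: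
  [set pendant_edge p | p : {v : vertex H & 'I_(l v)}].

Lemma pendant_edges_neq0 : set0 \notin pendant_edges.
Proof.
rewrite inE negb_or; apply/andP; split; apply/imsetP => -[].
  move=> e eH /esym/eqP; rewrite imset_eq0 => /eqP e0.
  by move: (edges_neq0 H); rewrite -e0 eH.
by move=> p _ /esym/setP/(_ (inl (tag p))); rewrite !inE eqxx.
Qed.

Definition attach_pendant : hypergraph := Hypergraph pendant_edges_neq0.
End Pendant.

Section T1C.
Variable m : nat.

(* v_1, ..., v_4 are inl 0, ..., inl 3; the edge e_(i+1) has the private
   vertices inr (i, j). *)
Definition core_vertex : finType := ('I_4 + 'I_5 * 'I_(m - 2))%type.

(* The cycles v1 e1 v2 e2 v3 e3 v1 and v1 e3 v3 e4 v4 e5 v1 give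
   e1 = {v1,v2,..}, e2 = {v2,v3,..}, e3 = {v3,v1,..}, e4 = {v3,v4,..},
   e5 = {v4,v1,..}. *)
Definition core_ends (i : 'I_5) : 'I_4 * 'I_4 :=
  nth (ord0, ord0)
    [:: (inord 0, inord 1); (inord 1, inord 2); (inord 2, inord 0);
        (inord 2, inord 3); (inord 3, inord 0)] i.

Definition core_edge (i : 'I_5) : {set core_vertex} :=
  [set inl (core_ends i).1; inl (core_ends i).2] :|:
  [set inr (i, j) | j : 'I_(m - 2)].

Lemma core_edges_neq0 : set0 \notin [set core_edge i | i : 'I_5].
Proof.
apply/imsetP => -[i _] /esym/setP/(_ (inl (core_ends i).1)).
by rewrite !inE eqxx.
Qed.

Definition T1C_core : hypergraph := Hypergraph core_edges_neq0.

Definition T1C (l1 l2 l3 l4 : nat) : hypergraph :=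
  @attach_pendant m T1C_core
    (fun x => if x is inl i then nth 0 [:: l1; l2; l3; l4] (val (i : 'I_4))
              else 0).
End T1C.

Local Open Scope ring_scope.

Definition adjacency_matrix (C : numClosedFieldType) (m : nat)
    (H : hypergraph) : 'M[C]_#|vertex H| :=
  \matrix_(i, j)
    if adjacent (enum_val i) (enum_val j) then (m - 1)%:R^-1 else 0.

(* closed_field_poly_normal lists the roots of a polynomial over an
   algebraically closed field, with multiplicity.  The norms are real, hence
   totally ordered, so Num.max is the true maximum. *)
Definition spectral_radius (C : numClosedFieldType) (n : nat) (A : 'M[C]_n) :
    C :=
  \big[Num.max/0]_(z <- sval (closed_field_poly_normal (char_poly A))) `|z|.

Definition lambda1 (C : numClosedFieldType) (m : nat) (H : hypergraph) : C :=
  spectral_radius (adjacency_matrix C m H).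

(* Main.v *)
(* Write mu = (m - 1) lambda_1 for the power of a graph G, and c = (m - 2) / (mu - m + 3).
   Eliminating the new vertices from the eigenvalue equation shows that the Perron vector x,
   restricted to the vertices of G, satisfies
     mu x_u = sum_(w ~ u) (x_w + c (x_u + x_w)),
   and, conversely, extending x to the power of another graph on the same vertices shows by
   the Rayleigh principle that lambda_1 does not decrease when G is replaced by a graph of
   larger total weight sum_(uw edge) (2 x_u x_w + c (x_u + x_w)^2).  This weight of an edge
   is monotone and supermodular in (x_u, x_w).

   By Type I, G has k - 1 vertices and k edges.  If some vertex is adjacent to all others,
   the two remaining edges either meet, which gives T_1C(k-5,0,0,0), or are disjoint, and
   then there are only two loose cycles.  Otherwise let x_(v1) be maximal, x_q minimal and
   v2, v3, v4 the next largest entries, and compare G with the graph in which v1 is joined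
   to everything but q, and v2 to v3, v4 and q; its power is T_1C(k-6,0,1,0).  The edges of
   G avoiding v1 are the edges from each non-neighbour of v1 to its parent in a tree rooted
   at v1, and two more; the latter are dominated by v2v3 and v2v4, each parent edge at w by
   v1w, and one of them, together with v1q, by v1w and v2q.  In case of equality x satisfies
   the eigenvalue equations of both graphs, whose rows at v1 and v2 force G to have the
   claimed shape. *)

Require Import Defs.
From mathcomp Require Import all_boot all_order all_algebra.
From mathcomp Require Import spectral ring zify.

Set Implicit Arguments.
Unset Strict Implicit.
Unset Printing Implicit Defensive.

Import Order.TTheory GRing.Theory Num.Theory.

(** * Spectral radius of nonnegative symmetric matrices *)

Local Open Scope ring_scope.

Section SymmetricSpectrum.
Local Open Scope sesquilinear_scope.

Section SpectralRadius.
Variables (C : numClosedFieldType) (n : nat) (A : 'M[C]_n).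

Lemma mem_char_poly_roots (z : C) :
  (z \in sval (closed_field_poly_normal (char_poly A))) = eigenvalue A z.
Proof.
rewrite eigenvalue_root_char; case: closed_field_poly_normal => r /= ->.
by rewrite (monicP (char_poly_monic A)) scale1r root_prod_XsubC.
Qed.

Lemma spectral_radius_ge0 : 0 <= spectral_radius A.
Proof.
rewrite /spectral_radius; elim/big_ind: _ => // x y x0 y0.
by rewrite /Num.max; case: ifP.
Qed.

(** The order of [C] is partial, but norms are real and hence comparable, so [Num.max] is a true
    maximum along the list. *)
Lemma bigmax_norm (s : seq C) :
  (forall z, z \in s -> `|z| <= \big[Num.max/0]_(z <- s) `|z|) /\
  (s != [::] -> exists2 z, z \in s & `|z| = \big[Num.max/0]_(z <- s) `|z|).
Proof.
elim: s => [|a s [IH1 IH2]]; first by split.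
rewrite big_cons; set M := (\big[_/_]_(j <- s) _) in IH1 IH2 *.
have M0 : 0 <= M.
  rewrite /M; elim/big_ind: _ => // x y x0 y0.
  by rewrite /Num.max; case: ifP.
have cmp : (`|a| >=< M)%R by rewrite real_comparable // ger0_real.
split=> [z|_].
  rewrite inE comparable_le_max // => /orP[/eqP->|/IH1 ->]; first by rewrite lexx.
  by rewrite orbT.
rewrite /Num.max; case: ifPn => [lt_aM|_]; last by exists a; rewrite ?mem_head.
have [z sz <-] : exists2 z, z \in s & `|z| = M.
  apply: IH2; apply: contraTneq lt_aM => s0.
  by rewrite /M s0 big_nil normr_lt0.
by exists z; rewrite // inE sz orbT.
Qed.

Lemma norm_eigenvalue_le (z : C) : eigenvalue A z -> `|z| <= spectral_radius A.
Proof. by rewrite -mem_char_poly_roots; apply: (bigmax_norm _).1. Qed.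

Lemma spectral_radius_attained :
  (0 < n)%N -> exists2 z, eigenvalue A z & `|z| = spectral_radius A.
Proof.
move=> n0; have [a] := eigenvalue_closed A n0.
rewrite -mem_char_poly_roots => ar.
have [|z zr zE] := (bigmax_norm (sval (closed_field_poly_normal (char_poly A)))).2.
  by apply: contraTneq ar => ->.
by exists z; rewrite -?mem_char_poly_roots.
Qed.

End SpectralRadius.

Section Symmetric.
Variables (C : numClosedFieldType) (n : nat) (A : 'M[C]_n).
Hypothesis A_sym : A^T = A.
Hypothesis A_ge0 : forall i j, 0 <= A i j.
Let rho := spectral_radius A.

Let A_herm : A \is hermsymmx.
Proof.
apply: realsym_hermsym; first by apply/is_hermitianmxP; rewrite /= expr0 scale1r map_mx_id // A_sym.
by apply/mxOverP => i j; rewrite ger0_real.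
Qed.

(** Diagonalize [A] by a unitary [P] and write [u = c P]. The Rayleigh defect is then the sum of the
    terms [(rho - d_i) |c_i|^2], collected in [w]; this one identity gives the bound and its
    equality case. *)
Lemma rayleigh_spectral (u : 'rV[C]_n) :
  exists2 w : 'rV[C]_n, forall i, 0 <= w 0 i &
    rho * (u *m u ^t*) 0 0 - (u *m A *m u ^t*) 0 0 = \sum_i w 0 i /\
    ((forall i, w 0 i = 0) -> u *m A = rho *: u).
Proof.
set P := spectralmx A; set d := spectral_diag A.
have PU : P \is unitarymx by apply: spectral_unitarymx.
have AE : A = P ^t* *m diag_mx d *m P.
  by rewrite -invmx_unitary //; apply/orthomx_spectralP/hermitian_normalmx/A_herm.
have PtP : P ^t* *m P = 1%:M.
  by rewrite -invmx_unitary // mulVmx // unitarymx_unit.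
have PPt : P *m P ^t* = 1%:M by apply/unitarymxP.
have d_le i : d 0 i <= rho.
  have dr : d 0 i \is Num.real.
    by have /mxOverP := hermitian_spectral_diag_real A_herm; apply.
  apply: le_trans (real_ler_norm dr) _; apply: norm_eigenvalue_le.
  apply/eigenvalueP; exists (row i P).
    rewrite AE !mulmxA -row_mul PPt row1 -rowE.
    by rewrite row_diag_mx -scalemxAl -rowE.
  apply: contraTneq isT => /(congr1 (mulmxr (P ^t*))) /=.
  rewrite -row_mul PPt mul0mx row1 => /matrixP/(_ 0 i).
  by rewrite !mxE !eqxx => /eqP; rewrite oner_eq0.
have [c uE] : exists c, u = c *m P by exists (u *m P ^t*); rewrite -mulmxA PtP mulmx1.
have ut : u ^t* = P ^t* *m c ^t*.
  by rewrite uE trmx_mul map_mxM.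
exists (\row_i ((rho - d 0 i) * `|c 0 i| ^+ 2)) => [i|].
  by rewrite mxE mulr_ge0 ?subr_ge0 ?d_le ?exprn_ge0.
split.
  rewrite AE ut uE !mulmxA -!(mulmxA _ P (P ^t*)) PPt !mulmx1.
  rewrite [(c *m _) 0 0]mxE [(_ *m c ^t*) 0 0]mxE mulr_sumr -sumrB.
  apply: eq_bigr => i _; rewrite mul_mx_diag !mxE normCK mulrBl.
  by rewrite -!mulrA [c 0 i * (d 0 i * _)]mulrCA.
move=> w0; rewrite AE uE !mulmxA -(mulmxA c P) PPt mulmx1 scalemxAl.
congr (_ *m P); apply/rowP => i; rewrite mul_mx_diag !mxE.
have /eqP := w0 i; rewrite mxE mulf_eq0 expf_eq0 /= normr_eq0 => /orP[|].
  by rewrite subr_eq0 => /eqP ->; rewrite mulrC.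
by move=> /eqP ->; rewrite mulr0 mul0r.
Qed.

Lemma rayleigh_le (u : 'rV[C]_n) :
  (u *m A *m u ^t*) 0 0 <= rho * (u *m u ^t*) 0 0.
Proof.
have [w w0 [E _]] := rayleigh_spectral u.
by rewrite -subr_ge0 E; apply: sumr_ge0.
Qed.

Lemma rayleigh_eq (u : 'rV[C]_n) :
  rho * (u *m u ^t*) 0 0 <= (u *m A *m u ^t*) 0 0 -> u *m A = rho *: u.
Proof.
have [w w0 [E F]] := rayleigh_spectral u.
rewrite -subr_le0 E => s0; apply: F => i.
have /eqP : \sum_i w 0 i = 0 by apply: le_anti; rewrite s0 sumr_ge0.
by rewrite psumr_eq0 => [/allP/(_ i (mem_index_enum i))/eqP|j _].
Qed.

(** By the triangle inequality, the entrywise norm of an eigenvector whose eigenvalue has modulus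
    [rho] attains the Rayleigh bound; the equality case makes it an eigenvector for [rho] itself. *)
Lemma perron_nonneg : (0 < n)%N ->
  exists2 u : 'rV[C]_n, (forall i, 0 <= u 0 i) & u != 0 /\ u *m A = rho *: u.
Proof.
move=> n0; have [z /eigenvalueP[v vA v0] zE] := spectral_radius_attained A n0.
pose u : 'rV[C]_n := \row_i `|v 0 i|.
exists u => [i|]; first by rewrite mxE.
split.
  apply: contraNneq v0 => /rowP u0; apply/eqP/rowP => i.
  by have /eqP := u0 i; rewrite !mxE normr_eq0 => /eqP.
apply: rayleigh_eq.
have -> : rho * (u *m u ^t*) 0 0 = `|(v *m A *m v ^t*) 0 0|.
  rewrite vA -scalemxAl [in RHS]mxE normrM zE; congr (_ * _); rewrite mxE [in RHS]mxE.
  rewrite ger0_norm => [|]; last by apply: sumr_ge0 => i _; rewrite !mxE mul_conjC_ge0.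
  by apply: eq_bigr => i _; rewrite !mxE -!normCK normr_id.
rewrite !mxE; apply: le_trans (ler_norm_sum _ _ _) _.
apply: ler_sum => i _; rewrite !mxE normrM norm_conjC conj_normC.
apply: ler_wpM2r => //; apply: le_trans (ler_norm_sum _ _ _) _.
by apply: ler_sum => j _; rewrite !mxE normrM (ger0_norm (A_ge0 _ _)).
Qed.

End Symmetric.

End SymmetricSpectrum.

(** * Perron vectors of hypergraphs *)

Lemma adjacent_sym (H : hypergraph) : symmetric (@adjacent H).
Proof.
move=> x y; rewrite /adjacent eq_sym; congr (_ && _).
by apply: eq_existsb => e; rewrite [(x \in e) && _]andbC.
Qed.

Lemma isomorphic_sym (H1 H2 : hypergraph) : isomorphic H1 H2 -> isomorphic H2 H1.
Proof.
move=> [f [[g fK gK] fE]]; exists g; split; first by exists f.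
rewrite fE; apply/setP => e; apply/idP/imsetP => [eH|[_ /imsetP[e' e'H ->] ->]].
  exists (f @: e); first exact: imset_f.
  by rewrite -imset_comp -[LHS]imset_id; apply: eq_imset => x /=; rewrite fK.
rewrite -imset_comp (_ : [set _ | _ in _] = e') //.
by rewrite -[RHS]imset_id; apply: eq_imset => x /=; rewrite fK.
Qed.

Lemma isomorphic_trans (H1 H2 H3 : hypergraph) :
  isomorphic H1 H2 -> isomorphic H2 H3 -> isomorphic H1 H3.
Proof.
move=> [f [fB fE]] [g [gB gE]]; exists (g \o f); split; first exact: bij_comp.
rewrite gE fE -imset_comp; apply: eq_imset => e /=; by rewrite imset_comp.
Qed.

Lemma adjacent_iso (H1 H2 : hypergraph) (f : vertex H1 -> vertex H2) :
  injective f -> edges H2 = [set f @: (e : {set vertex H1}) | e in edges H1] ->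
  {mono f : x y / adjacent x y}.
Proof.
move=> f_inj fE x y; rewrite /adjacent (inj_eq f_inj); congr (_ && _).
apply/existsP/existsP => -[e /and3P[]].
  rewrite fE => /imsetP[e' e'H ->]; rewrite !mem_imset // => xe ye.
  by exists e'; rewrite e'H xe.
move=> eH xe ye; exists (f @: e).
by apply/and3P; split; rewrite ?fE; apply: imset_f.
Qed.

Section Lambda1.
Local Open Scope sesquilinear_scope.
Variables (C : numClosedFieldType) (m : nat) (H : hypergraph).
Hypothesis m_ge2 : (2 <= m)%N.

(** This is the spectral radius of the 0-1 matrix of [adjacent]; the factor removes [1/(m-1)] from
    the row equations. *)
Definition scaled_lambda1 : C := (m - 1)%:R * lambda1 C m H.
Let A := adjacency_matrix C m H.

Let m1_gt0 : 0 < (m - 1)%:R :> C.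
Proof. by rewrite ltr0n subn_gt0. Qed.

Let A_sym : A^T = A.
Proof. by apply/matrixP => i j; rewrite !mxE adjacent_sym. Qed.

Let A_ge0 i j : 0 <= A i j.
Proof. by rewrite mxE; case: ifP => // _; rewrite invr_ge0 ltW. Qed.

Let row_of (x : vertex H -> C) : 'rV[C]_#|vertex H| := \row_i x (enum_val i).

Let row_of_mul x i :
  (m - 1)%:R * (row_of x *m A) 0 i = \sum_(v | adjacent (enum_val i) v) x v.
Proof.
rewrite mxE mulr_sumr [RHS]big_mkcond [RHS](reindex _ (onW_bij _ (@enum_val_bij (vertex H)))) /=.
apply: eq_bigr => j _; rewrite !mxE adjacent_sym; case: ifP => _.
  by rewrite mulrCA divff ?mulr1 // gt_eqF.
by rewrite !mulr0.
Qed.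

Let row_of_sqr x : (forall u, 0 <= x u) ->
  (row_of x *m (row_of x) ^t*) 0 0 = \sum_u x u ^+ 2.
Proof.
move=> x0; rewrite mxE [RHS](reindex _ (onW_bij _ (@enum_val_bij (vertex H)))) /=.
by apply: eq_bigr => i _; rewrite !mxE conj_Creal ?ger0_real // expr2.
Qed.

Let row_of_form x : (forall u, 0 <= x u) ->
  (m - 1)%:R * (row_of x *m A *m (row_of x) ^t*) 0 0 =
  \sum_u \sum_(v | adjacent u v) x u * x v.
Proof.
move=> x0; rewrite mxE mulr_sumr [RHS](reindex _ (onW_bij _ (@enum_val_bij (vertex H)))) /=.
apply: eq_bigr => i _; rewrite mulrA row_of_mul !mxE conj_Creal ?ger0_real //.
by rewrite mulrC mulr_sumr.
Qed.

Lemma lambda1_ge0 : 0 <= lambda1 C m H.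
Proof. exact: spectral_radius_ge0. Qed.

Lemma lambda1_perron : (0 < #|vertex H|)%N ->
  exists x : vertex H -> C,
    [/\ forall u, 0 <= x u, exists u, x u != 0
      & forall u, \sum_(v | adjacent u v) x v = scaled_lambda1 * x u].
Proof.
move=> n0; have [r r0 [rn rE]] := perron_nonneg A_sym A_ge0 n0.
pose x u := r 0 (enum_rank u).
have xE : row_of x = r by apply/rowP => i; rewrite mxE /x enum_valK.
exists x; split=> [u||u]; first exact: r0.
  have [j rj] := rV0Pn _ rn.
  by exists (enum_val j); rewrite /x enum_valK.
rewrite -{1}(enum_rankK u) -row_of_mul xE rE mxE mulrA.
by rewrite /scaled_lambda1 /lambda1.
Qed.

Lemma lambda1_rayleigh_le (x : vertex H -> C) : (forall u, 0 <= x u) ->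
  \sum_u \sum_(v | adjacent u v) x u * x v <= scaled_lambda1 * \sum_u x u ^+ 2.
Proof.
move=> x0; rewrite -row_of_form // -row_of_sqr // -mulrA ler_pM2l //.
exact: rayleigh_le.
Qed.

Lemma lambda1_rayleigh_eq (x : vertex H -> C) : (forall u, 0 <= x u) ->
  scaled_lambda1 * \sum_u x u ^+ 2 <= \sum_u \sum_(v | adjacent u v) x u * x v ->
  forall u, \sum_(v | adjacent u v) x v = scaled_lambda1 * x u.
Proof.
move=> x0; rewrite -row_of_form // -row_of_sqr // -mulrA ler_pM2l //.
move=> /(rayleigh_eq A_sym A_ge0) xE u.
rewrite -{1}(enum_rankK u) -row_of_mul xE !mxE enum_rankK mulrA.
by rewrite /scaled_lambda1 /lambda1.
Qed.

End Lambda1.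

Lemma lambda1_iso_le (C : numClosedFieldType) (m : nat) (H1 H2 : hypergraph) :
  (2 <= m)%N -> (0 < #|vertex H1|)%N -> isomorphic H1 H2 ->
  lambda1 C m H1 <= lambda1 C m H2.
Proof.
move=> m2 n0 [f [[g fK gK] fE]].
have [x [x0 [w xw] xE]] := lambda1_perron C m2 n0.
have fB : bijective f by exists g.
have gB : bijective g by exists f.
have := lambda1_rayleigh_le m2 (fun u => x0 (g u)).
have -> : \sum_u \sum_(v | adjacent u v) x (g u) * x (g v) =
          scaled_lambda1 C m H1 * \sum_u x u ^+ 2.
  rewrite (reindex f (onW_bij _ fB)) /= mulr_sumr; apply: eq_bigr => u _.
  rewrite (reindex f (onW_bij _ fB)) /= expr2 mulrCA -xE mulr_sumr.
  rewrite (eq_bigl _ _ (adjacent_iso (can_inj fK) fE u)).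
  by apply: eq_bigr => v _; rewrite !fK.
rewrite -(reindex g (onW_bij _ gB) (P := predT) (F := fun u => x u ^+ 2)) /=.
rewrite /scaled_lambda1 -!mulrA ler_pM2l ?ltr0n ?subn_gt0 // ler_pM2r //.
rewrite (bigD1 w) //= ltr_wpDr ?sumr_ge0 // => [u _|]; first by rewrite exprn_ge0.
by rewrite exprn_gt0 // lt_def xw x0.
Qed.

Lemma card_iso (H1 H2 : hypergraph) : isomorphic H1 H2 ->
  #|vertex H1| = #|vertex H2| /\ #|edges H1| = #|edges H2|.
Proof.
move=> [f [fB fE]]; split; first exact: bij_eq_card fB.
by rewrite fE card_imset //; apply: imset_inj; apply: bij_inj.
Qed.

Lemma lambda1_iso (C : numClosedFieldType) (m : nat) (H1 H2 : hypergraph) :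
  (2 <= m)%N -> (0 < #|vertex H1|)%N -> isomorphic H1 H2 ->
  lambda1 C m H1 = lambda1 C m H2.
Proof.
move=> m2 n0 H12; apply/le_anti/andP; split; apply: lambda1_iso_le => //.
  by rewrite -(card_iso H12).1.
exact: isomorphic_sym.
Qed.

(** At a zero of [x] the nonnegative neighbouring entries sum to zero, so the zero set is closed
    under adjacency; connectedness would make it everything. *)
Lemma perron_pos (C : numClosedFieldType) (H : hypergraph)
    (mu : C) (x : vertex H -> C) :
  connected_hypergraph H -> (forall u, 0 <= x u) -> (exists u, x u != 0) ->
  (forall u, \sum_(v | adjacent u v) x v = mu * x u) ->
  forall u, 0 < x u.
Proof.
move=> Hc x0 [w xw] xE u; rewrite lt_def x0 andbT; apply: contraNneq xw => xu.
pose a := [pred v | x v == 0].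
have a_cl : closed (@adjacent H) a.
  apply: intro_closed; first exact: sym_connect_sym (@adjacent_sym H).
  move=> y z yz; rewrite !inE => /eqP y0.
  have := xE y; rewrite y0 mulr0 => /eqP.
  by rewrite psumr_eq0 // => /allP/(_ z (mem_index_enum z)); rewrite yz.
by have := closed_connect a_cl (Hc u w); rewrite !inE xu eqxx => <-.
Qed.

(** * Power hypergraphs of graphs *)

Section Graph.
Variable G : hypergraph.
Hypothesis G2 : uniform 2 G.

Lemma adjacent_edge (u w : vertex G) : adjacent u w = ([set u; w] \in edges G).
Proof.
apply/andP/idP => [[nuw /existsP[e /and3P[eG ue we]]]|uwG].
  suff -> : [set u; w] = e by [].
  by apply/eqP; rewrite eqEcard subUset !sub1set ue we (G2 eG) cards2 nuw.
have := G2 uwG; rewrite cards2; case: (u =P w) => // _ _; split=> //.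
by apply/existsP; exists [set u; w]; rewrite uwG !inE !eqxx orbT.
Qed.

Lemma edge_neq (u w : vertex G) : [set u; w] \in edges G -> u != w.
Proof. by rewrite -adjacent_edge => /andP[]. Qed.

Lemma edge_other (e : {set vertex G}) (u : vertex G) : e \in edges G -> u \in e ->
  exists2 w, u != w & e = [set u; w].
Proof.
move=> eG ue; have /cards1P[w ew] : #|e :\ u| == 1%N.
  by have /eqP := cardsD1 u e; rewrite (G2 eG) ue add1n eqSS eq_sym.
exists w; last by rewrite -(setD1K ue) ew.
have : w \in e :\ u by rewrite ew inE.
by rewrite !inE eq_sym => /andP[].
Qed.

Section Sums.
Variable R : nmodType.

Lemma sum_edges_at (u : vertex G) (F : {set vertex G} -> R) :
  \sum_(e in edges G | u \in e) F e = \sum_(w | adjacent u w) F [set u; w].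
Proof.
have inj : {in adjacent u &, injective (fun w => [set u; w])}.
  move=> w w' /andP[nuw _] /andP[nuw' _] /setP/(_ w); rewrite !inE eqxx orbT.
  by rewrite eq_sym (negPf nuw) => /esym/eqP.
rewrite -(big_imset F inj) /=; apply: eq_bigl => e.
apply/andP/imsetP => [[eG ue]|[w uw ->]].
  by have [w nuw ew] := edge_other eG ue; exists w => //; rewrite -topredE /= adjacent_edge -ew.
rewrite -topredE /= adjacent_edge in uw.
by rewrite uw !inE eqxx.
Qed.

Lemma sum_adjacent (F : vertex G -> vertex G -> R) :
  \sum_u \sum_(w | adjacent u w) F u w =
  \sum_(e in edges G) \sum_(u in e) \sum_(w in e :\ u) F u w.
Proof.
rewrite [RHS](exchange_big_dep predT) //=; apply: eq_bigr => u _.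
rewrite (sum_edges_at u (fun e => \sum_(w in e :\ u) F u w)).
apply: eq_bigr => w /andP[nuw _].
by rewrite setU1K ?big_set1 // inE.
Qed.

End Sums.

End Graph.

Section PowerSums.
Variables (m : nat) (G : hypergraph).
Let P := power m G.
Let E : finType := {e : {set vertex G} | e \in edges G}.
Local Notation vtx u := (inl u : vertex P).
Local Notation prv e j := (inr (e, j) : vertex P).

Lemma mem_power_edge_inl (e : E) (u : vertex G) :
  (vtx u \in power_edge m e) = (u \in val e).
Proof.
rewrite inE mem_imset; last by move=> ? ? [].
by rewrite orbC; case: imsetP => // -[].
Qed.

Lemma mem_power_edge_inr (e e' : E) (j : 'I_(m - 2)) :
  (prv e' j \in power_edge m e) = (e' == e).
Proof.
rewrite inE; case: imsetP => [[]//|_] /=.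
by apply/imsetP/eqP => [[j' _ [->]]//|->]; exists j.
Qed.

Lemma power_edge_inj : injective (@power_edge m G).
Proof.
move=> e e' ee'; apply/val_inj/setP => u.
by rewrite -!mem_power_edge_inl ee'.
Qed.

Lemma power_edgesP (f : {set vertex P}) :
  reflect (exists e : E, f = power_edge m e) (f \in edges P).
Proof.
apply: (iffP imsetP) => [[e _ ->]|[e ->]]; first by exists e.
by exists e.
Qed.

Let card_E : #|{: E}| = #|edges G|.
Proof. by rewrite card_sig; apply: eq_card. Qed.

Lemma card_power_vertices : #|vertex P| = (#|vertex G| + #|edges G| * (m - 2))%N.
Proof. by rewrite -card_E card_sum card_prod card_ord. Qed.

Lemma card_power_edges : #|edges P| = #|edges G|.
Proof. by rewrite -card_E card_imset //; apply: power_edge_inj. Qed.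

Lemma adjacent_inl_inl u w : adjacent (vtx u) (vtx w) = adjacent u w.
Proof.
rewrite /adjacent (_ : (vtx u == vtx w) = (u == w)) //; congr (_ && _).
apply/existsP/existsP => -[f /and3P[fP uf wf]].
  have [e fe] := power_edgesP _ fP; move: uf wf; rewrite fe !mem_power_edge_inl.
  by move=> ue we; exists (val e); rewrite ue we (valP e).
exists (power_edge m (Sub f fP : E)); rewrite !mem_power_edge_inl uf wf.
by rewrite imset_f.
Qed.

Lemma adjacent_inl_inr u (e : E) j : adjacent (vtx u) (prv e j) = (u \in val e).
Proof.
apply/existsP/idP => [[f /and3P[fP]]|ue].
  have [e' ->] := power_edgesP _ fP.
  by rewrite mem_power_edge_inl mem_power_edge_inr => ue /eqP->.
exists (power_edge m e); rewrite mem_power_edge_inl mem_power_edge_inr ue eqxx.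
by rewrite imset_f.
Qed.

Lemma adjacent_inr_inr (e e' : E) j j' :
  adjacent (prv e j) (prv e' j') = (e == e') && (j != j').
Proof.
apply/andP/andP => [[n /existsP[f /and3P[fP]]]|[/eqP-> nj]].
  have [d fd] := power_edgesP _ fP; rewrite fd !mem_power_edge_inr.
  move=> /eqP ed /eqP e'd; move: n; rewrite ed e'd eqxx; split=> //.
  by apply: contraNneq n => ->.
split; first by apply: contraNneq nj => -[->].
by apply/existsP; exists (power_edge m e'); rewrite !mem_power_edge_inr eqxx imset_f.
Qed.

Variables (R : nmodType) (f : vertex P -> R).

Lemma sum_adjacent_inl u :
  \sum_(v | adjacent (vtx u) v) f v =
  \sum_(w | adjacent u w) f (inl w) +
  \sum_(e : E | u \in val e) \sum_j f (inr (e, j)).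
Proof.
rewrite big_sumType /=; congr (_ + _).
  by apply: eq_bigl => w; rewrite adjacent_inl_inl.
rewrite pair_big_dep /=; apply: eq_big => [[e j]|[e j] _] //=.
by rewrite adjacent_inl_inr andbT.
Qed.

Lemma sum_adjacent_inr (e : E) j :
  \sum_(v | adjacent (prv e j) v) f v =
  \sum_(w in val e) f (inl w) + \sum_(j' | j' != j) f (inr (e, j')).
Proof.
rewrite big_sumType /=; congr (_ + _).
  by apply: eq_bigl => w; rewrite adjacent_sym adjacent_inl_inr.
transitivity (\sum_(e' | e' == e) \sum_(j' | j' != j) f (inr (e', j'))); last first.
  by rewrite big_pred1_eq.
rewrite pair_big_dep /=; apply: eq_big => [[e' j']|[e' j'] _] //=.
by rewrite adjacent_inr_inr eq_sym [j == _]eq_sym.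
Qed.

End PowerSums.

(** * Eigenvalue equations of a power, reduced to the graph *)

Section PowerSpectrum.
Variables (C : numClosedFieldType) (m : nat) (G : hypergraph).
Hypotheses (m_ge2 : (2 <= m)%N) (G2 : uniform 2 G).
Let P := power m G.
Let E : finType := {e : {set vertex G} | e \in edges G}.

Definition edge_sum (x : vertex G -> C) (e : {set vertex G}) : C := \sum_(w in e) x w.

(** The right-hand side of the eigenvalue equation at [u] after elimination: [c * (x u + x w)] is
    the total of the entries at the new vertices of the edge [uw]. *)
Definition twisted_row (c : C) (x : vertex G -> C) (u : vertex G) : C :=
  \sum_(w | adjacent u w) (x w + c * (x u + x w)).

Lemma sum_edge_subtype (F : {set vertex G} -> C) u :
  \sum_(e : E | u \in val e) F (val e) = \sum_(w | adjacent u w) F [set u; w].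
Proof.
rewrite -(sum_edges_at G2)
  [RHS](reindex_omap (val : E -> {set vertex G}) (insub : _ -> option E)) /=.
  by apply: eq_bigl => e; rewrite valK eqxx (valP e) andbT.
by move=> e /andP[eG _]; rewrite insubT.
Qed.

Lemma edge_sum2 x u w : u != w -> edge_sum x [set u; w] = x u + x w.
Proof. by move=> nuw; rewrite /edge_sum big_setU1 ?inE //= big_set1. Qed.

Lemma twisted_rowE c x u :
  \sum_(w | adjacent u w) x w + \sum_(e : E | u \in val e) c * edge_sum x (val e) =
  twisted_row c x u.
Proof.
rewrite (sum_edge_subtype (fun e => c * edge_sum x e)) -big_split /=.
by apply: eq_bigr => w /andP[nuw _]; rewrite edge_sum2.
Qed.

(** The extension [z] satisfies the equations for [mu] at all new vertices, so its Rayleigh defect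
    on the power equals that of [x] on [G]; the Rayleigh principle and its equality case apply to
    [z]. *)
Lemma power_rayleigh (mu : C) (x : vertex G -> C) :
  let kappa := mu + 1 - (m - 2)%:R in
  let c := (m - 2)%:R / kappa in
  0 < kappa -> (forall u, 0 <= x u) -> (exists u, 0 < x u) ->
  mu * \sum_u x u ^+ 2 <= \sum_u x u * twisted_row c x u ->
  mu <= scaled_lambda1 C m P /\
  (mu = scaled_lambda1 C m P -> forall u, twisted_row c x u = mu * x u).
Proof.
move=> kappa c k0 x0 [u0 xu0] le_mu.
(* The entry [t] at a new vertex of [uw] solves [mu t = x_u + x_w + (m - 3) t], and [mu - m + 3] is
   [kappa]. *)
pose z (v : vertex P) : C :=
  match v with inl u => x u | inr (e, j) => edge_sum x (val e) / kappa end.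
have z0 v : 0 <= z v.
  case: v => [u|[e j]] /=; first exact: x0.
  by rewrite divr_ge0 ?(ltW k0) // sumr_ge0.
have row_inl u : \sum_(v | adjacent (inl u : vertex P) v) z v = twisted_row c x u.
  rewrite sum_adjacent_inl /= -twisted_rowE; congr (_ + _).
  apply: eq_bigr => e _; rewrite sumr_const card_ord /c -[LHS]mulr_natl.
  by rewrite mulrA mulrAC.
have row_inr e j : \sum_(v | adjacent (inr (e, j) : vertex P) v) z v = mu * z (inr (e, j)).
  rewrite sum_adjacent_inr /= sumr_const.
  have -> : (#|[pred j' | j' != j]| = m - 2 - 1)%N.
    by rewrite (cardC1 j) card_ord subn1.
  have m2 : (1 <= m - 2)%N by rewrite (leq_trans _ (ltn_ord j)).
  rewrite -/(edge_sum x (val e)) -mulr_natl natrB //.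
  have -> : mu = kappa + ((m - 2)%:R - 1) by rewrite /kappa; ring.
  by rewrite [RHS]mulrDl [kappa * _]mulrCA divff ?mulr1 // gt_eqF.
have form : \sum_u \sum_(v | adjacent u v) z u * z v - mu * \sum_u z u ^+ 2 =
    \sum_u x u * twisted_row c x u - mu * \sum_u x u ^+ 2.
  rewrite mulr_sumr [in RHS]mulr_sumr -!sumrB big_sumType /= [X in _ + X]big1 ?addr0.
    apply: eq_bigr => u _; rewrite -mulr_sumr -row_inl; congr (_ - _).
  move=> [e j] _; rewrite -mulr_sumr row_inr expr2 mulrCA subrr //.
have z2 : 0 < \sum_u z u ^+ 2.
  rewrite (bigD1 (inl u0)) //= ltr_wpDr ?exprn_gt0 // sumr_ge0 // => v _.
  by rewrite exprn_ge0.
have le_form : mu * \sum_u z u ^+ 2 <= \sum_u \sum_(v | adjacent u v) z u * z v.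
  by rewrite -subr_ge0 form subr_ge0.
split=> [|muE u].
  rewrite -(ler_pM2r z2); apply: le_trans le_form _.
  exact: lambda1_rayleigh_le.
rewrite -row_inl [RHS](_ : _ = mu * z (inl u)) // muE.
by apply: (lambda1_rayleigh_eq m_ge2 z0); rewrite -muE.
Qed.

(** The sum [s] of the new entries on an edge satisfies [kappa s = (m - 2)(x_u + x_w)]. For [m > 2]
    positivity of the Perron vector gives [kappa > 0]; for [m = 2], [kappa = mu + 1]. *)
Lemma power_perron :
  connected_hypergraph P -> edges G != set0 ->
  let mu := scaled_lambda1 C m P in
  let kappa := mu + 1 - (m - 2)%:R in
  let c := (m - 2)%:R / kappa in
  0 < kappa /\
  exists2 x : vertex G -> C,
    forall u, 0 < x u & forall u, twisted_row c x u = mu * x u.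
Proof.
move=> Pc /set0Pn[e0 e0G] mu kappa c.
have [u0 u0e0] : exists u0, u0 \in e0.
  by apply/set0Pn; apply: contraNneq (edges_neq0 G) => <-.
have n0 : (0 < #|vertex P|)%N by apply/card_gt0P; exists (inl u0).
have [z [z0 zn zE]] := lambda1_perron C m_ge2 n0.
have zpos : forall v, 0 < z v := perron_pos Pc z0 zn zE.
pose x u := z (inl u); pose s (e : E) := \sum_j z (inr (e, j)).
(* Adding the vertex's own entry to both sides makes the right-hand side independent of [j]. *)
have prvE e j : (mu + 1) * z (inr (e, j)) = edge_sum x (val e) + s e.
  have := zE (inr (e, j)); rewrite sum_adjacent_inr -/mu => muE.
  rewrite mulrDl -muE mul1r -addrA; congr (_ + _).
  by rewrite /s [RHS](bigD1 j) //= addrC.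
have sE e : kappa * s e = (m - 2)%:R * edge_sum x (val e).
  have : (mu + 1) * s e = (m - 2)%:R * (edge_sum x (val e) + s e).
    rewrite {1}/s mulr_sumr (eq_bigr _ (fun j _ => prvE e j)) sumr_const.
    by rewrite card_ord mulr_natl.
  by rewrite /kappa mulrBl => ->; rewrite mulrDr addrK.
have mu0 : 0 <= mu by rewrite mulr_ge0 // lambda1_ge0.
have k0 : 0 < kappa.
  have [m2|m2] := posnP (m - 2); first by rewrite /kappa m2 subr0 ltr_wpDl.
  pose e : E := Sub e0 e0G.
  have x0 : 0 < edge_sum x (val e).
    rewrite /edge_sum (bigD1 u0) //=; apply: ltr_wpDr; last exact: zpos.
    by apply: sumr_ge0 => w _; apply: z0.
  have s0 : 0 < s e.
    rewrite /s (bigD1 (Ordinal m2)) //=; apply: ltr_wpDr; last exact: zpos.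
    by apply: sumr_ge0.
  by rewrite -(pmulr_lgt0 _ s0) sE mulr_gt0 ?ltr0n.
split=> //; exists x => u; first exact: zpos.
rewrite -twisted_rowE -zE sum_adjacent_inl; congr (_ + _).
apply: eq_bigr => e _; rewrite -/(s e).
apply: (mulfI (lt0r_neq0 k0)); rewrite sE /c mulrA mulrCA mulfV ?mulr1 //.
exact: lt0r_neq0.
Qed.

End PowerSpectrum.

(** * Shifting edges towards large entries *)

(** [h] is the distance from [r], and [p v] the predecessor of [v] on a shortest path. *)
Lemma connect_parent (V : finType) (e : rel V) (r : V) :
  (forall v, connect e r v) ->
  exists (p : V -> V) (h : V -> nat),
    forall v, v != r -> e (p v) v /\ (h (p v) < h v)%N.
Proof.
move=> er.
pose reach v k := [exists t : k.-tuple V, path e r t && (last r t == v)].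
have hP v : exists k, reach v k.
  have /connectP[s rs ->] := er v.
  by exists (size s); apply/existsP; exists (in_tuple s); rewrite rs eqxx.
pose h v := ex_minn (hP v).
suff /fin_all_exists[p pP] : forall v, exists p, v != r -> e p v /\ (h p < h v)%N.
  by exists p, h.
move=> v; have [->|vr] := eqVneq v r; first by exists r.
rewrite {2}/h; case: ex_minnP => k /existsP[[s /= /eqP <-]].
case/lastP: s => [|s z]; first by rewrite /= eq_sym (negPf vr).
rewrite rcons_path last_rcons size_rcons => /andP[/andP[rs sz] /eqP <-] _.
exists (last r s) => _; split=> //.
rewrite /h; case: ex_minnP => k' _; apply.
by apply/existsP; exists (in_tuple s); rewrite rs eqxx.
Qed.

Section EdgeWeight.
Variables (C : numDomainType) (c : C).
Hypothesis c_ge0 : 0 <= c.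

(** What a neighbour with entry [b] adds to the twisted row at a vertex with entry [a]. The
    symmetric [edge_weight a b] below equals [2ab + c(a + b)^2]. *)
Definition half_weight (a b : C) : C := b + c * (a + b).
Definition edge_weight (a b : C) : C := a * half_weight a b + b * half_weight b a.

Lemma edge_weightC a b : edge_weight a b = edge_weight b a.
Proof. by rewrite /edge_weight addrC. Qed.

Lemma half_weight_gt0 a b : 0 <= a -> 0 < b -> 0 < half_weight a b.
Proof.
by move=> a0 b0; rewrite ltr_pwDl // mulr_ge0 // addr_ge0 // ltW.
Qed.

Lemma half_weight_mono a b b' : b <= b' -> half_weight a b <= half_weight a b'.
Proof. by move=> bb; rewrite lerD // ler_wpM2l // lerD2l. Qed.

Lemma half_weight_mono_lt a b b' : b < b' -> half_weight a b < half_weight a b'.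
Proof. by move=> bb; rewrite ltr_leD // ler_wpM2l // lerD2l ltW. Qed.

Lemma edge_weight_mono a b a' b' : 0 <= a -> 0 <= b -> a <= a' -> b <= b' ->
  edge_weight a b <= edge_weight a' b'.
Proof.
move=> a0 b0 aa bb.
have a'0 := le_trans a0 aa; have b'0 := le_trans b0 bb.
rewrite /edge_weight /half_weight lerD // ler_pM //.
- by rewrite addr_ge0 // mulr_ge0 // addr_ge0.
- by rewrite lerD // ler_wpM2l // lerD.
- by rewrite addr_ge0 // mulr_ge0 // addr_ge0.
- by rewrite lerD // ler_wpM2l // lerD.
Qed.

(** Supermodularity: the two sides differ by [2(1 + c)(a - a')(b - b')]. *)
Lemma edge_weight_swap a a' b b' : a' <= a -> b' <= b ->
  edge_weight b a' + edge_weight a b' <= edge_weight a' b' + edge_weight a b.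
Proof.
move=> aa bb; rewrite -subr_ge0 /edge_weight /half_weight.
have -> : a' * (b' + c * (a' + b')) + b' * (a' + c * (b' + a')) +
    (a * (b + c * (a + b)) + b * (a + c * (b + a))) -
    (b * (a' + c * (b + a')) + a' * (b + c * (a' + b)) +
     (a * (b' + c * (a + b')) + b' * (a + c * (b' + a)))) =
  2%:R * (1 + c) * ((a - a') * (b - b')) by ring.
by apply: mulr_ge0; apply: mulr_ge0; rewrite ?subr_ge0 // addr_ge0.
Qed.

End EdgeWeight.

(** One shape for both graphs that matter: a singleton [Q] leads to [T_1C(k-6,0,1,0)], the empty [Q]
    to [T_1C(k-5,0,0,0)]. *)
Definition hub_edges (V : finType) (Q : {set V}) (v1 v2 v3 v4 : V) : {set {set V}} :=
  [set [set v1; j] | j in ~: (v1 |: Q)] :|: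
  [set [set v2; j] | j in [set v3; v4] :|: Q].

Section Weight.
Variables (C : numClosedFieldType) (G : hypergraph) (c : C) (x : vertex G -> C).
Hypotheses (G2 : uniform 2 G) (c_ge0 : 0 <= c).

(** Summing over ordered pairs in [e] avoids choosing its ends; on a pair it is [edge_weight]. *)
Definition set_weight (e : {set vertex G}) : C :=
  \sum_(u in e) \sum_(w in e :\ u) x u * half_weight c (x u) (x w).

Lemma set_weight2 u w : u != w -> set_weight [set u; w] = edge_weight c (x u) (x w).
Proof.
move=> nuw; rewrite /set_weight big_setU1 ?inE //= big_set1; congr (_ + _).
  by rewrite setU1K ?inE // big_set1.
by rewrite setUC setU1K ?inE 1?eq_sym // big_set1.
Qed.

Lemma sum_twisted_row :
  \sum_u x u * twisted_row c x u = \sum_(e in edges G) set_weight e.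
Proof.
rewrite -(sum_adjacent G2); apply: eq_bigr => u _; rewrite mulr_sumr.
exact: eq_bigr.
Qed.

End Weight.

Section AvoidingEdges.
Variables (G : hypergraph) (r : vertex G).
Hypothesis G2 : uniform 2 G.

Definition edges_avoiding : {set {set vertex G}} := [set e in edges G | r \notin e].
Definition nonneighbours : {set vertex G} := [set w | (w != r) && ~~ adjacent r w].

(** The edges through [r] correspond to its neighbours, so removing them from the [n + 1] edges and
    from the [n - 1] other vertices preserves the difference two. *)
Lemma card_edges_avoiding :
  #|edges G| = #|vertex G|.+1 -> #|edges_avoiding| = #|nonneighbours|.+2.
Proof.
move=> card_G.
have cN : #|[set e in edges G | r \in e]| = #|[set w | adjacent r w]|.
  have := sum_edges_at G2 r (fun=> 1%N).
  rewrite !sum1_card => cE; rewrite !cardsE.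
  by rewrite (eq_card (B := [pred e | (e \in edges G) && (r \in e)])).
have cW : (#|[set w | adjacent r w]| + #|nonneighbours|).+1 = #|vertex G|.
  rewrite -cardsT [RHS](cardsD1 r) in_setT /= add1n; congr _.+1.
  rewrite -(cardsID [set w | adjacent r w] (_ :\ _)); congr (_ + _)%N.
    apply: eq_card => w; rewrite !inE andbT; case: (w =P r) => [->|//].
    by rewrite /adjacent eqxx.
  by apply: eq_card => w; rewrite !inE andbT andbC.
apply: (@addnI #|[set e in edges G | r \in e]|).
rewrite cN !addnS cW -card_G -cN -(cardsID [set e : {set vertex G} | r \in e] (edges G)).
congr (_ + _)%N; apply: eq_card => e; rewrite !inE //.
by rewrite andbC.
Qed.

Lemma edges_avoidingP e : e \in edges_avoiding ->
  exists a b, [/\ e = [set a; b], a != b, a != r & b != r].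
Proof.
rewrite inE => /andP[eG re].
have [a ae] : exists a, a \in e.
  by apply/set0Pn; rewrite -card_gt0 (G2 eG).
have [b nab eE] := edge_other G2 eG ae; exists a, b; split=> //.
  by apply: contraNneq re => <-.
by apply: contraNneq re => <-; rewrite eE !inE eqxx orbT.
Qed.

End AvoidingEdges.

(** * Total weight of the graph against that of the two-hub graph *)

Section Shift.
Variables (C : numClosedFieldType) (G : hypergraph) (c : C) (x : vertex G -> C).
Hypotheses (G2 : uniform 2 G) (c_ge0 : 0 <= c).
Hypothesis card_G : #|edges G| = #|vertex G|.+1.
Variables (v1 v2 v3 v4 q : vertex G).
Hypothesis G_conn : forall v, connect (@adjacent G) v1 v.
Hypothesis v_uniq : uniq [:: v1; v2; v3; v4; q].
Hypothesis x_gt0 : forall v, 0 < x v.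
Hypothesis x1_max : forall v, x v <= x v1.
Hypothesis x2_max : forall v, v != v1 -> x v <= x v2.
Hypothesis x3_max : forall v, v != v1 -> v != v2 -> x v <= x v3.
Hypothesis x4_max : forall v, v != v1 -> v != v2 -> v != v3 -> x v <= x v4.
Hypothesis xq_min : forall v, x q <= x v.
Variable w0 : vertex G.
Hypotheses (w0_neq : w0 != v1) (w0_nadj : ~~ adjacent v1 w0).

Let q1 : q != v1.
Proof. by rewrite eq_sym; move: v_uniq; rewrite /= !inE !negb_or => /andP[/and4P[]]. Qed.

Let x_ge0 v : 0 <= x v. Proof. exact: ltW. Qed.
Local Notation phi u w := (edge_weight c (x u) (x w)).
Local Notation psi u w := (half_weight c (x u) (x w)).
Let W := nonneighbours v1.
Let E' := edges_avoiding v1.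

Let sum_split :
  \sum_(e in edges G) set_weight c x e =
  \sum_(w | adjacent v1 w) phi v1 w + \sum_(e in E') set_weight c x e.
Proof.
rewrite (bigID (fun e : {set _} => v1 \in e)) /=; congr (_ + _).
  rewrite (sum_edges_at G2); apply: eq_bigr => w /andP[nw _].
  by rewrite set_weight2.
by apply: eq_bigl => e; rewrite inE.
Qed.

(** One of the two ends is not [v2]; its entry is at most [x v3], the other at most [x v2]. *)
Let le_v23 a b : a != v1 -> b != v1 -> a != b -> phi a b <= phi v2 v3.
Proof.
move=> a1 b1; wlog b2 : a b a1 b1 / b != v2.
  move=> W' nab; have [b2|nb2] := eqVneq b v2; last exact: W'.
  rewrite edge_weightC; apply: W' => //; last by rewrite eq_sym.
  by rewrite -b2.
by move=> _; apply: edge_weight_mono; rewrite ?x2_max ?x3_max.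
Qed.

(** One end lies outside [{v2, v3}], so its entry is at most [x v4]. *)
Let le_v24 a b : a != v1 -> b != v1 -> a != b -> [set a; b] != [set v2; v3] ->
  phi a b <= phi v2 v4.
Proof.
move=> a1 b1; wlog /andP[b2 b3] : a b a1 b1 / (b != v2) && (b != v3).
  move=> W' nab nE; have [b23|nb23] := boolP ((b != v2) && (b != v3)).
    exact: W'.
  rewrite edge_weightC; apply: W' => //; last by rewrite setUC.
    apply: contraR nE; rewrite negb_and !negbK => a23.
    move: nb23; rewrite negb_and !negbK.
    move: a23 nab => /orP[]/eqP-> nab /orP[]/eqP bE; rewrite bE ?eqxx // in nab *.
    by rewrite setUC.
  by rewrite eq_sym.
by move=> _ _; apply: edge_weight_mono; rewrite ?x2_max ?x4_max.
Qed.

Lemma shift_le :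
  \sum_(e in edges G) set_weight c x e <=
  \sum_(w in ~: [set v1; q]) phi v1 w + (phi v2 v3 + phi v2 v4 + phi v2 q).
Proof.
have [p [h ph]] := connect_parent G_conn.
(* The parent edge of a non-neighbour [j] of [v1] avoids [v1], since [p j] is adjacent to [j] and so
   is not [v1]. *)
pose tau j := [set p j; j].
have tauE' j : j \in W -> tau j \in E'.
  rewrite !inE => /andP[j1 nj]; have [pj _] := ph j j1.
  rewrite -(adjacent_edge G2) pj negb_or [v1 == j]eq_sym j1 andbT.
  by apply: contraNneq nj => ->.
have tau_inj : {in W &, injective tau}.
  move=> i j; rewrite !inE => /andP[i1 _] /andP[j1 _] eij.
  (* An edge that is the parent edge of both its ends would make [h] decrease in both directions. *)
  have [_ hi] := ph i i1; have [_ hj] := ph j j1.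
  have : i \in tau j by rewrite -eij !inE eqxx orbT.
  have : j \in tau i by rewrite eij !inE eqxx orbT.
  rewrite !inE => /orP[/eqP jE|/eqP-> //] /orP[/eqP iE|/eqP-> //].
  by move: hi hj; rewrite -jE -iE => hi hj; have := ltn_trans hi hj; rewrite ltnn.
have tauS : tau @: W \subset E' by apply/subsetP => _ /imsetP[j jW ->]; apply: tauE'.
(* By the count of edges avoiding [v1], exactly two of them are not parent edges. *)
have : #|E' :\: tau @: W| == 2.
  by rewrite cardsD (setIidPr tauS) card_in_imset //
             (card_edges_avoiding v1 G2 card_G) -addn2 addKn.
case/cards2P => e1 [e2 [e12 eE]].
have sum_two : \sum_(e in E' :\: tau @: W) set_weight c x e <= phi v2 v3 + phi v2 v4.
  have sE : [set e1; e2] \subset E' by rewrite -eE subsetDl.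
  have [e1E e2E] : e1 \in E' /\ e2 \in E'.
    by split; apply: (subsetP sE); rewrite !inE eqxx ?orbT.
  rewrite eE big_setU1 ?inE //= big_set1.
  have [a1 [b1 [e1E' nab1 a11 b11]]] := edges_avoidingP G2 e1E.
  have [a2 [b2 [e2E' nab2 a21 b21]]] := edges_avoidingP G2 e2E.
  (* At most one of the two edges is [v2v3], so one that is not can be charged to [v2v4] and the
     other to [v2v3]. *)
  have [e23|ne23] := eqVneq e1 [set v2; v3].
    rewrite e1E' e2E' !set_weight2 // lerD //; first exact: le_v23.
    by apply: le_v24; rewrite // -e2E' -e23 eq_sym.
  rewrite addrC e1E' e2E' !set_weight2 // lerD //; first exact: le_v23.
  by apply: le_v24; rewrite // -e1E'.
have w0W : w0 \in W by rewrite inE w0_neq.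
have pv1 j : j \in W -> p j != v1.
  move=> jW; have := tauE' j jW; rewrite inE => /andP[_].
  by apply: contraNneq => <-; rewrite !inE eqxx.
have sum_tau : \sum_(e in tau @: W) set_weight c x e =
    phi w0 (p w0) + \sum_(j in W :\ w0) phi j (p j).
  rewrite big_imset //= (big_setD1 w0) //=.
  have tw j : j \in W -> set_weight c x (tau j) = phi j (p j).
    move=> jW; rewrite set_weight2 1?edge_weightC //.
    have := tauE' j jW; rewrite inE => /andP[+ _].
    exact: edge_neq.
  rewrite tw //; congr (_ + _); apply: eq_bigr => j; rewrite inE => /andP[_].
  exact: tw.
rewrite sum_split (big_setID (tau @: W)) /= (setIidPr tauS) sum_tau.
have sum_W : \sum_(j in W :\ w0) phi j (p j) <= \sum_(j in W :\ w0) phi v1 j.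
  apply: ler_sum => j; rewrite inE => /andP[_ jW].
  by rewrite [X in _ <= X]edge_weightC edge_weight_mono.
have sum_v1 : \sum_(w | adjacent v1 w) phi v1 w + \sum_(j in W :\ w0) phi v1 j + phi v1 w0 =
    \sum_(w in ~: [set v1; q]) phi v1 w + phi v1 q.
  rewrite -addrA [X in _ + X]addrC -(big_setD1 w0 w0W) /=.
  transitivity (\sum_(w | w != v1) phi v1 w).
    rewrite [RHS](bigID (adjacent v1)) /=; congr (_ + _).
      apply: eq_bigl => w; case: (w =P v1) => [->|//].
      by rewrite /adjacent eqxx.
    by apply: eq_bigl => w; rewrite inE.
  rewrite (bigD1 q) /= ?q1 // addrC; congr (_ + _).
  by apply: eq_bigl => w; rewrite !inE negb_or.
(* As [p w0] is not [v1], its entry is at most [x v2]; supermodularity then trades [w0 v2] and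
   [v1 q] for [v2 q] and [v1 w0]. *)
have swap : phi w0 (p w0) + phi v1 q <= phi v2 q + phi v1 w0.
  apply: le_trans (edge_weight_swap c_ge0 (x1_max v2) (xq_min w0)).
  by rewrite lerD2r edge_weight_mono // x2_max // pv1.
(* With these terms added, the full sum of [phi v1 w] over [w != v1] appears on both sides, and
   [swap] compares what remains. *)
rewrite -(lerD2r (phi v1 w0 + phi v1 q)).
apply: (@le_trans _ _ ((\sum_(w | adjacent v1 w) phi v1 w +
    \sum_(j in W :\ w0) phi v1 j + phi v1 w0)
    + (phi w0 (p w0) + phi v1 q) + (phi v2 v3 + phi v2 v4))).
  rewrite [X in _ <= X](_ : _ = \sum_(w | adjacent v1 w) phi v1 w +
    (phi w0 (p w0) + \sum_(j in W :\ w0) phi v1 j + (phi v2 v3 + phi v2 v4)) +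
    (phi v1 w0 + phi v1 q)); last by ring.
  by rewrite lerD2r lerD2l lerD // lerD2l.
rewrite sum_v1.
rewrite [X in _ <= X](_ : _ = \sum_(w in ~: [set v1; q]) phi v1 w + phi v1 q +
    (phi v2 q + phi v1 w0) + (phi v2 v3 + phi v2 v4)); last by ring.
by rewrite lerD2r lerD2l.
Qed.

Let v_neq : [/\ v1 != v2, v1 != v3 & v1 != v4] /\
            [/\ v2 != v3, v2 != v4 & v2 != q] /\ [/\ v3 != v4, v3 != q & v4 != q].
Proof.
move: v_uniq; rewrite /= !inE !negb_or -!andbA.
by case/and5P=> -> -> -> _ /and5P[-> -> -> -> /and3P[-> -> _]].
Qed.

Hypothesis q_choice : ~~ adjacent v1 q \/
  (forall w, w != v1 -> ~~ adjacent v1 w -> x q < x w).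
Hypothesis row1 : twisted_row c x v1 = \sum_(w in ~: [set v1; q]) psi v1 w.
Hypothesis row2 :
  twisted_row c x v2 = psi v2 v1 + psi v2 v3 + psi v2 v4 + psi v2 q.

Let psi_gt0 u w : 0 < psi u w.
Proof. exact: half_weight_gt0. Qed.

(** By [row1] the neighbours of [v1] weigh as much as all vertices but [v1] and [q]. If [q] were a
    neighbour, the missing [w0], of larger entry, would make the row too small; given that [q] is
    none, so would any further non-neighbour. *)
Let adj_v1 w : adjacent v1 w = (w != v1) && (w != q).
Proof.
have sum_nv1 (a : pred (vertex G)) w' : w' != v1 -> (forall w, a w -> w != v1) ->
    ~~ a w' -> \sum_(w | a w) psi v1 w + psi v1 w' <= \sum_(w | w != v1) psi v1 w.
  move=> w'1 a1 aw'; rewrite [X in _ <= X](bigD1 w') //= [X in X <= _]addrC lerD2l.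
  rewrite [X in _ <= X](bigID a) /= [X in _ <= X + _](eq_bigl a); last first.
    move=> v; case: (boolP (a v)) => aw; rewrite ?andbF // andbT a1 //=.
    by apply: contraNneq aw' => <-.
  by rewrite lerDl sumr_ge0 // => v _; rewrite ltW.
have row1' : twisted_row c x v1 + psi v1 q = \sum_(w | w != v1) psi v1 w.
  rewrite row1 [RHS](bigD1 q) //= addrC; congr (_ + _).
  by apply: eq_bigl => v; rewrite !inE negb_or.
have adj1 w' : adjacent v1 w' -> w' != v1 by case/andP; rewrite eq_sym.
have nq : ~~ adjacent v1 q.
  case: q_choice => // /(_ w0 w0_neq w0_nadj) xqw.
  have := sum_nv1 _ _ w0_neq adj1 w0_nadj.
  rewrite -row1' lerD2l => /le_lt_trans/(_ (half_weight_mono_lt c_ge0 (x v1) xqw)).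
  by rewrite ltxx.
apply/idP/andP => [wa|[w1 wq]].
  by split; [exact: adj1 | apply: contraTneq wa => ->].
apply/negPn/negP => nw.
have := sum_nv1 [pred v | adjacent v1 v || (v == q)] w w1.
rewrite (bigD1 q) /= ?eqxx ?orbT // negb_or nw wq -row1' => /(_ _ isT).
rewrite (eq_bigl (adjacent v1)) => [le_row|v]; last first.
  by case: eqP => [->|]; rewrite ?orbF ?andbT // (negPf nq) andbF.
have : twisted_row c x v1 + psi v1 q + psi v1 w <= twisted_row c x v1 + psi v1 q.
  rewrite [X in X + psi v1 w <= _]addrC; apply: le_row => v /orP[/adj1 //|/eqP->] //.
by rewrite gerDl (lt_geF (psi_gt0 _ _)).
Qed.

(** Now [q] is the only non-neighbour of [v1], so three edges avoid [v1], and [row2] forces them all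
    through [v2]. Ties among entries leave open whether [u3], [u4] are [v3], [v4]. *)
Lemma shift_eq : exists u3 u4,
  uniq [:: v1; v2; u3; u4; q] /\ edges G = hub_edges [set q] v1 v2 u3 u4.
Proof.
have [[n12 n13 n14] [[n23 n24 n2q] [n34 n3q n4q]]] := v_neq.
have WE : W = [set q].
  apply/setP => w; rewrite !inE adj_v1; have [->|_] /= := eqVneq w v1.
    by rewrite eq_sym (negPf q1).
  by rewrite negbK.
have E'3 : #|E'| = 3%N by rewrite (card_edges_avoiding v1 G2 card_G) -/W WE cards1.
pose B := [set b | adjacent v2 b & b != v1].
have B_inj : {in B &, injective (fun b => [set v2; b])}.
  move=> b b'; rewrite !inE => /andP[/andP[nb _] _] _ /setP/(_ b).
  by rewrite !inE eqxx orbT eq_sym (negPf nb) => /esym/eqP.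
have BE' : [set [set v2; b] | b in B] \subset E'.
  apply/subsetP => _ /imsetP[b + ->]; rewrite inE (adjacent_edge G2) => /andP[bG b1].
  by rewrite inE bG !inE negb_or n12 eq_sym.
have B3 : (#|B| <= 3)%N by rewrite -E'3 -(card_in_imset B_inj) subset_leq_card.
have sumB : \sum_(b in B) psi v2 b = psi v2 v3 + psi v2 v4 + psi v2 q.
  apply: (addrI (psi v2 v1)); transitivity (twisted_row c x v2); last by rewrite row2 -!addrA.
  rewrite /twisted_row [RHS](bigD1 v1) /=; last by rewrite adjacent_sym adj_v1 eq_sym n12.
  by congr (_ + _); apply: eq_bigl => b; rewrite inE.
have Bv b : b \in B -> b != v1 /\ b != v2.
  by rewrite inE => /andP[/andP[n _] ->]; rewrite eq_sym.
have psi3 b : b \in B -> psi v2 b <= psi v2 v3.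
  by move=> /Bv[b1 b2]; apply: half_weight_mono => //; apply: x3_max.
have psi4 b : b \in B -> b != v3 -> psi v2 b <= psi v2 v4.
  by move=> /Bv[b1 b2] b3; apply: half_weight_mono => //; apply: x4_max.
have not_le : ~ \sum_(b in B) psi v2 b <= psi v2 v3 + psi v2 v4.
  by rewrite sumB gerDl (lt_geF (psi_gt0 _ _)).
(* At most two vertices in [B] weigh no more than [v3] and [v4] together, short of [row2] by the
   positive [psi v2 q]. *)
have cB : #|B| = 3%N.
  case: (ltngtP #|B| 3%N) B3 => // B3 _; case: not_le.
  move: B3; rewrite ltnS leq_eqVlt => /orP[|].
    move=> /cards2P[b1 [b2 [nb BE]]]; rewrite BE big_setU1 ?inE //= big_set1.
    have [b1B b2B] : b1 \in B /\ b2 \in B by rewrite BE !inE !eqxx orbT.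
    have [b13|nb13] := eqVneq b1 v3; last by rewrite addrC lerD ?psi3 ?psi4.
    by rewrite lerD ?psi3 ?psi4 // -b13 eq_sym.
  rewrite ltnS leq_eqVlt => /orP[/cards1P[b BE]|].
    rewrite BE big_set1 ler_wpDr ?psi3 ?BE ?inE // ltW //.
  by rewrite ltnS leqn0 cards_eq0 => /eqP->; rewrite big_set0 addr_ge0 // ltW.
have E'E : E' = [set [set v2; b] | b in B].
  by apply/esym/eqP; rewrite eqEcard BE' (card_in_imset B_inj) cB E'3.
(* The parent edge of [q] avoids [v1], hence is one of the edges from [v2] to [B]. *)
have qB : q \in B.
  have [p [h ph]] := connect_parent G_conn.
  have [pq _] := ph q q1.
  have : [set p q; q] \in E'.
    rewrite inE -(adjacent_edge G2) pq !inE negb_or [v1 == q]eq_sym q1 andbT.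
    by apply: contraTneq pq => <-; rewrite adj_v1 eqxx andbF.
  rewrite E'E => /imsetP[b bB /setP/(_ q)]; rewrite !inE eqxx orbT [q == v2]eq_sym.
  by rewrite (negPf n2q) => /esym/eqP qb; move: bB; rewrite -qb inE.
have : #|B :\ q| == 2%N.
  by have /eqP := cardsD1 q B; rewrite cB qB add1n eqSS eq_sym.
case/cards2P => u3 [u4 [n34' BE]].
have BE3 : B = [set u3; u4] :|: [set q] by rewrite -BE setUC setD1K.
have [u3B u4B] : u3 \in B :\ q /\ u4 \in B :\ q by rewrite BE !inE !eqxx orbT.
move: u3B u4B; rewrite !in_setD1 => /andP[u3q /Bv[u31 u32]] /andP[u4q /Bv[u41 u42]].
exists u3, u4; split.
  rewrite /= !inE !negb_or n12 n2q n34' u3q u4q [v1 == q]eq_sym q1.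
  by rewrite ![v1 == _]eq_sym ![v2 == _]eq_sym u31 u41 u32 u42.
apply/setP => e; rewrite /hub_edges -BE3 -E'E inE [e \in E']inE.
have [v1e|v1e] := boolP (v1 \in e); rewrite ?andbF ?andbT ?orbF /=.
  apply/idP/imsetP => [eG|[w]].
    have [w nw eE] := edge_other G2 eG v1e; exists w => //.
    by rewrite !inE negb_or -(adj_v1 w) (adjacent_edge G2) -eE.
  by rewrite !inE negb_or -adj_v1 (adjacent_edge G2) => + ->.
by case: imsetP => // -[w _ eE]; rewrite eE !inE eqxx in v1e.
Qed.

End Shift.

(** * Recognizing T1C *)

Local Close Scope ring_scope.

Lemma surj_card_bij (T T' : finType) (f : T -> T') :
  (forall y, exists x, f x = y) -> #|T| = #|T'| -> bijective f.
Proof.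
move=> /fin_all_exists[g gK] cT.
have g_bij : bijective g by apply: inj_card_bij (can_inj gK) _; rewrite cT.
exact: (bij_can_bij g_bij).
Qed.

Section HubEdges.
Variables (V : finType) (Q : {set V}) (v1 v2 v3 v4 : V).

Lemma mem_hub_edges1 w :
  w != v1 -> w \notin Q -> [set v1; w] \in hub_edges Q v1 v2 v3 v4.
Proof.
move=> w1 wQ; apply/setUP; left; apply/imsetP; exists w => //.
by rewrite !inE negb_or w1.
Qed.

Lemma mem_hub_edges2 w :
  w \in [set v3; v4] :|: Q -> [set v2; w] \in hub_edges Q v1 v2 v3 v4.
Proof. by move=> wQ; apply/setUP; right; apply/imsetP; exists w. Qed.

End HubEdges.

Section HubPower.
Variables (m : nat) (G : hypergraph) (Q : {set vertex G}) (v1 v2 v3 v4 : vertex G).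
Hypotheses (m_ge2 : 2 <= m) (card_G : #|edges G| = #|vertex G|.+1).
Hypothesis v_uniq : uniq [:: v1; v2; v3; v4].
Hypothesis Q_v : [disjoint Q & [set v1; v2; v3; v4]].
Hypothesis G_edges : edges G = hub_edges Q v1 v2 v3 v4.

Let E : finType := {e : {set vertex G} | e \in edges G}.
Let leaves (i : 'I_4) : {set vertex G} :=
  nth set0 [:: ~: (Q :|: [set v1; v2; v3; v4]); set0; Q; set0] i.
Let l1 := #|vertex G| - 4 - #|Q|.
Let T := T1C m l1 0 #|Q| 0.
Let l (x : vertex (T1C_core m)) : nat :=
  if x is inl i then nth 0 [:: l1; 0; #|Q|; 0] (val (i : 'I_4)) else 0.
Let pendant : finType := {x : vertex (T1C_core m) & 'I_(l x)}.

Let card_v : #|[set v1; v2; v3; v4]| = 4.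
Proof.
have /card_uniqP /= <- := v_uniq; apply: eq_card => v.
by rewrite !inE -!orbA.
Qed.

Let card_leaves0 : #|~: (Q :|: [set v1; v2; v3; v4])| = l1.
Proof.
by rewrite cardsCs setCK cardsU (disjoint_setI0 Q_v) cards0 subn0 card_v addnC subnDA.
Qed.

Let card_leaves i : #|leaves i| = nth 0 [:: l1; 0; #|Q|; 0] i.
Proof.
by case: i => -[|[|[|[|]]]] //= ? ; rewrite /leaves /= ?card_leaves0 ?cards0.
Qed.

(** In the core of [T1C] the vertices on three edges have indices 0 and 2, so the hubs [v1] and [v2]
    go there; [leaves] follows the same indexing. *)
Let core (i : 'I_4) : vertex G := nth v1 [:: v1; v3; v2; v4] i.

Let core_inord k : k < 4 -> core (inord k) = nth v1 [:: v1; v3; v2; v4] k.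
Proof. by move=> k4; rewrite /core inordK. Qed.

Let core_pair (i : 'I_5) : {set vertex G} :=
  [set core (core_ends i).1; core (core_ends i).2].

Let hub (p : pendant) : vertex G := if tag p is inl i then core i else v1.
Let leaf (p : pendant) : vertex G :=
  if tag p is inl i then nth v1 (enum (leaves i)) (tagged p) else v1.

Let v12G : [set v1; v2] \in edges G.
Proof.
rewrite G_edges mem_hub_edges1 //.
  by rewrite eq_sym; move: v_uniq; rewrite /= !inE !negb_or => /andP[/and3P[]].
by rewrite (disjointFl Q_v) // !inE eqxx orbT.
Qed.

(** The default edge [v1v2] spares membership proofs inside [to_power], where every set it is
    applied to is an edge. *)
Let edge (e : {set vertex G}) : E := insubd (Sub [set v1; v2] v12G : E) e.

Let edgeK e : e \in edges G -> val (edge e) = e.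
Proof. by move=> eG; rewrite insubdK. Qed.

(* The last of the m - 1 new vertices of a pendant edge plays the leaf of the
   graph, the others the new vertices of the power. *)
Let to_power (x : vertex T) : vertex (power m G) :=
  match x with
  | inl (inl i) => inl (core i)
  | inl (inr (i, j)) => inr (edge (core_pair i), j)
  | inr (p, j) =>
      if insub (j : nat) is Some j' then inr (edge [set hub p; leaf p], j')
      else inl (leaf p)
  end.

Let Pendant (i : 'I_4) u : u \in leaves i ->
  exists p : pendant, hub p = core i /\ leaf p = u.
Proof.
move=> ui; have ul : index u (enum (leaves i)) < l (inl i).
  by rewrite /l -card_leaves cardE index_mem mem_enum.
exists (Tagged (fun x => 'I_(l x)) (Ordinal ul)); split=> //.
by rewrite /leaf /= nth_index // mem_enum.
Qed.

Let pendantP (p : pendant) : exists i, [/\ tag p = inl i, hub p = core i & leaf p \in leaves i].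
Proof.
case: p => -[i|[i j]] t; last by case: t.
exists i; split=> //; rewrite /leaf /= -mem_enum mem_nth // -cardE card_leaves.
exact: ltn_ord t.
Qed.

Let inl_surj u : u \in [set v1; v2; v3; v4] \/ exists i, u \in leaves i.
Proof.
have [|uv] := boolP (u \in [set v1; v2; v3; v4]); first by left.
right; have [uQ|uQ] := boolP (u \in Q).
  by exists (Ordinal (isT : 2 < 4)).
by exists ord0; rewrite /leaves /= inE in_setU negb_or uQ.
Qed.

Let core_pair_edge i : core_pair i \in edges G.
Proof.
have vQ v : v \in [set v1; v2; v3; v4] -> v \notin Q.
  by move=> vv; apply: contraL vv => vQ; rewrite (disjointFr Q_v).
move: v_uniq; rewrite /= !inE !negb_or -!andbA => /and5P[n12 n13 n14 n23 /and3P[n24 n34 _]].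
have v1w w : w != v1 -> w \in [set v1; v2; v3; v4] -> [set v1; w] \in edges G.
  by move=> w1 wv; rewrite G_edges mem_hub_edges1 // vQ.
have v2w w : w \in [set v3; v4] -> [set v2; w] \in edges G.
  by move=> wv; rewrite G_edges mem_hub_edges2 // inE wv.
case: i => -[|[|[|[|[|]]]]] //= ?; rewrite /core_pair /core_ends /= !core_inord //=.
- by rewrite v1w ?inE ?eqxx ?orbT // eq_sym.
- by rewrite setUC v2w ?inE ?eqxx.
- by rewrite setUC v1w ?inE ?eqxx ?orbT // eq_sym.
- by rewrite v2w ?inE ?eqxx ?orbT.
- by rewrite setUC v1w ?inE ?eqxx ?orbT // eq_sym.
Qed.

Let pendant_pair_edge p : [set hub p; leaf p] \in edges G.
Proof.
have [i [_ -> ]] := pendantP p; rewrite G_edges.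
case: i => -[|[|[|[|]]]] //= i4; rewrite /leaves /core /= => lp; try by rewrite inE in lp.
  rewrite !inE !negb_or -!andbA in lp; case/and5P: lp => lQ lv1 _ _ _.
  exact: mem_hub_edges1.
by rewrite mem_hub_edges2 // !inE lp orbT.
Qed.

Let edge_surj e : e \in edges G ->
  (exists i, e = core_pair i) \/ (exists p, e = [set hub p; leaf p]).
Proof.
rewrite G_edges => /setUP[] /imsetP[w + ->].
  rewrite !inE negb_or => /andP[w1 wQ].
  have [|wv] := boolP (w \in [set v1; v2; v3; v4]).
    rewrite !inE (negPf w1) /= => wv; left.
    case/orP: wv => [/orP[]|] /eqP->.
    - exists (Ordinal (isT : 2 < 5)); rewrite /core_pair /core_ends /= !core_inord //=.
      by rewrite setUC.
    - by exists (Ordinal (isT : 0 < 5)); rewrite /core_pair /core_ends /= !core_inord.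
    - exists (Ordinal (isT : 4 < 5)); rewrite /core_pair /core_ends /= !core_inord //=.
      by rewrite setUC.
  have wl : w \in leaves ord0 by rewrite /leaves /= inE in_setU negb_or wQ.
  by right; have [p [hp lp]] := Pendant wl; exists p; rewrite hp lp.
rewrite !inE => /orP[/orP[]/eqP->|wQ].
- left; exists (Ordinal (isT : 1 < 5)); rewrite /core_pair /core_ends /= !core_inord //=.
  by rewrite setUC.
- by left; exists (Ordinal (isT : 3 < 5)); rewrite /core_pair /core_ends /= !core_inord.
right; have [|p [hp lp]] := @Pendant (Ordinal (isT : 2 < 4)) w; first by [].
by exists p; rewrite hp lp.
Qed.

(** Together with [card_T] this gives bijectivity without constructing an inverse. *)
Let to_power_surj y : exists x, to_power x = y.
Proof.
case: y => [u|[e j]].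
  case: (inl_surj u) => [|[i ui]].
    rewrite !inE -!orbA => /or4P[]/eqP->.
    - by exists (inl (inl (Ordinal (isT : 0 < 4)))).
    - by exists (inl (inl (Ordinal (isT : 2 < 4)))).
    - by exists (inl (inl (Ordinal (isT : 1 < 4)))).
    - by exists (inl (inl (Ordinal (isT : 3 < 4)))).
  have [p [_ <-]] := Pendant ui.
  (* The index [m - 2], last of the [m - 1], is the one sent to the leaf. *)
  have mlt : m - 2 < m - 1 by case: (m) m_ge2 => [|[|k]] // _; rewrite !subSS !subn0.
  by exists (inr (p, Ordinal mlt)); rewrite /= insubF //= ltnn.
have [[i eE]|[p eE]] := edge_surj (valP e).
  by exists (inl (inr (i, j))) => /=; congr (inr (_, _)); apply: val_inj; rewrite edgeK.
have jlt : j < m - 1.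
  by apply: leq_trans (ltn_ord j) _; rewrite leq_sub2l.
exists (inr (p, Ordinal jlt)) => /=; rewrite valK.
by congr (inr (_, _)); apply: val_inj; rewrite edgeK.
Qed.

Let card_pendant : #|{: pendant}| = l1 + #|Q|.
Proof.
rewrite card_tagged sumnE big_map big_enum /= big_sumType /= [X in _ + X]big1 ?addn0.
  by rewrite !big_ord_recl big_ord0 !card_ord /= add0n !addn0.
by move=> [i j] _; rewrite card_ord.
Qed.

(** With [n] the order of [G], five core edges and [n - 4] pendant edges give [n + (n + 1)(m - 2)]
    vertices on both sides. *)
Let card_T : #|vertex T| = #|vertex (power m G)|.
Proof.
have n4 : #|Q| + 4 <= #|vertex G|.
  rewrite -card_v -[X in X <= _]subn0 -(cards0 (vertex G)) -(disjoint_setI0 Q_v).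
  by rewrite -cardsU max_card.
have -> : #|vertex T| = 4 + 5 * (m - 2) + (l1 + #|Q|) * (m - 1).
  by rewrite card_sum card_prod card_sum card_prod !card_ord -card_pendant.
rewrite card_power_vertices.
have [k ->] : exists k, m = k.+2 by exists (m - 2); rewrite -addn2 subnK.
have [j jE] : exists j, #|vertex G| = #|Q| + 4 + j.
  by exists (#|vertex G| - (#|Q| + 4)); rewrite subnKC.
have -> : l1 = j by rewrite /l1 -subnDA jE [4 + _]addnC addKn.
rewrite card_G jE !subSS !subn0; ring.
Qed.

Let to_power_core i : to_power @: (inl @: core_edge m i) = power_edge m (edge (core_pair i)).
Proof.
rewrite -imset_comp /core_edge imsetU imsetU1 imset_set1 /power_edge edgeK //.
rewrite imsetU1 imset_set1; congr (_ :|: _).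
by rewrite -imset_comp; apply: eq_imset.
Qed.

Let to_power_pendant (p : pendant) :
  to_power @: pendant_edge m p = power_edge m (edge [set hub p; leaf p]).
Proof.
have inl_hub : to_power (inl (tag p)) = inl (hub p).
  by have [i [-> -> _]] := pendantP p; rewrite /=.
rewrite /pendant_edge imsetU1 inl_hub /power_edge edgeK // imsetU1 imset_set1 -setUA.
congr (_ |: _); rewrite -imset_comp; apply/setP => y; apply/imsetP/idP.
  move=> [j _ ->] /=; case: insubP => [j' _ _|_]; last by rewrite !inE eqxx.
  by apply/setUP; right; apply/imsetP; exists j'.
move=> /setU1P[->|/imsetP[j _ ->]].
  have mlt : m - 2 < m - 1 by case: (m) m_ge2 => [|[|k]] // _; rewrite !subSS !subn0.
  by exists (Ordinal mlt); rewrite //= insubF //= ltnn.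
have jlt : j < m - 1 by apply: leq_trans (ltn_ord j) _; rewrite leq_sub2l.
by exists (Ordinal jlt); rewrite //= valK.
Qed.

Lemma hub_power_iso : isomorphic (power m G) (T1C m (#|vertex G| - 4 - #|Q|) 0 #|Q| 0).
Proof.
apply: isomorphic_sym; exists to_power.
split; first exact: surj_card_bij to_power_surj card_T.
apply/setP => f; apply/imsetP/imsetP => [[e _ ->]|[t tT ->]].
  have [[i eE]|[p eE]] := edge_surj (valP e).
    exists (inl @: core_edge m i).
      by apply/setUP; left; apply: imset_f; apply: imset_f.
    by rewrite to_power_core; congr power_edge; apply: val_inj; rewrite edgeK.
  exists (pendant_edge m p).
    by apply/setUP; right; apply: imset_f.
  by rewrite to_power_pendant; congr power_edge; apply: val_inj; rewrite edgeK.
case/setUP: tT => /imsetP[].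
  by move=> _ /imsetP[i _ ->] ->; exists (edge (core_pair i)); rewrite ?to_power_core.
by move=> p _ ->; exists (edge [set hub p; leaf p]); rewrite ?to_power_pendant.
Qed.

End HubPower.

(** * Loose cycles of power hypergraphs *)

Lemma val_ordS l (i : 'I_l) : val (ordS i) = if i.+1 == l then 0 else i.+1.
Proof.
rewrite /=; have [->|ne] := eqVneq i.+1 l; first by rewrite modnn.
by rewrite modn_small // ltn_neqAle ne ltn_ord.
Qed.

Lemma ordS_neq l (i : 'I_l) : 2 <= l -> ordS i != i.
Proof. by move=> l2; rewrite -val_eqE val_ordS; case: (i.+1 =P l) => /= iE; lia. Qed.

Lemma ordSS_neq l (i : 'I_l) : 3 <= l -> ordS (ordS i) != i.
Proof.
move=> l3; rewrite -val_eqE !val_ordS; case: (i.+1 =P l) => /= iE.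
  by case: (1 =P l) => /= ?; lia.
by case: (i.+2 =P l) => /= ?; lia.
Qed.

Lemma ordSSS_eq l (i : 'I_l) : 3 <= l -> ordS (ordS (ordS i)) = i -> l = 3.
Proof.
move=> l3 /(congr1 val); rewrite !val_ordS; case: (i.+1 =P l) => /= iE.
  by case: (1 =P l) => /= ?; case: (2 =P l) => /= ?; lia.
case: (i.+2 =P l) => /= ?; first by case: (1 =P l) => /= ?; lia.
by case: (i.+3 =P l) => /= ?; lia.
Qed.

Lemma ordS_cover3 (i j : 'I_3) : [|| j == i, j == ordS i | j == ordS (ordS i)].
Proof.
by case: i => -[|[|[|]]] //= ?; case: j => -[|[|[|]]] //= ?.
Qed.

Section LooseCyclePower.
Variables (m : nat) (G : hypergraph).
Hypothesis G2 : uniform 2 G.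
Let E : finType := {e : {set vertex G} | e \in edges G}.

(** A new vertex lies in a single edge, while each [v i] lies in two distinct consecutive ones; so
    every [v i] is a vertex of [G]. *)
Lemma loose_cycle_power l (v : 'I_l -> vertex (power m G))
    (e : 'I_l -> {set vertex (power m G)}) :
  loose_cycle v e -> (forall i, e i \in edges (power m G)) ->
  exists (c : 'I_l -> vertex G) (g : 'I_l -> E),
    [/\ injective c, forall i, e i = power_edge m (g i)
      & forall i, val (g i) = [set c i; c (ordS i)]].
Proof.
move=> [l3 v_inj ee _] eP.
have /fin_all_exists[g gE] : forall i, exists d : E, e i = power_edge m d.
  by move=> i; apply/power_edgesP.
have ve i : v i \in e i by have := set11 (v i); rewrite -ee inE => /andP[].
have vSe i : v (ordS i) \in e i.
  by have := set11 (v (ordS i)); rewrite -ee ordSK inE => /andP[].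
(* Were they equal, both would be the singleton of [v i], yet [e i] also contains [v (ordS i)]. *)
have neP i : e (ord_pred i) != e i.
  apply/eqP => eE; have := vSe i; rewrite -[e i]setIid -{1}eE ee inE => /eqP/v_inj/eqP.
  by apply/negP; apply: ordS_neq; apply: leq_trans l3.
have /fin_all_exists[c cE] : forall i, exists u, v i = inl u.
  move=> i; case vE: (v i) => [u|[d j]]; first by exists u.
  have := set11 (v i); rewrite -ee inE !gE vE !mem_power_edge_inr => /andP[/eqP dE /eqP dE'].
  by case/eqP: (neP i); rewrite !gE -dE -dE'.
have c_inj : injective c by move=> i j cij; apply: v_inj; rewrite !cE cij.
exists c, g; split=> // i.
have := ve i; have := vSe i; rewrite gE !cE !mem_power_edge_inl => cSg cg.
apply/esym/eqP; rewrite eqEcard subUset !sub1set cg cSg (G2 (valP (g i))) cards2.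
by rewrite (inj_eq c_inj) eq_sym ordS_neq // (leq_trans _ l3).
Qed.

Section Dominated.
Variable r : vertex G.
Hypothesis avoid_meet : forall e f, e \in edges_avoiding r -> f \in edges_avoiding r ->
  e :&: f != set0 -> e = f.

(* The edges of the loose cycle r a b of the power, for e = {a, b}. *)
Definition triangle (e : {set vertex G}) : {set {set vertex (power m G)}} :=
  [set power_edge m d | d : E & (val d == e) || (r \in val d) && (val d :\ r \subset e)].

(** Three consecutive cycle vertices other than [r] would give two distinct edges that avoid [r] and
    meet. So [r] is among any three consecutive vertices, which forces length three. *)
Lemma loose_cycle_triangle F : contains_loose_cycle (H := power m G) F ->
  exists2 e, e \in edges_avoiding r & F = triangle e.
Proof.
move=> [FE [l [v [e [lc FI]]]]].
have l3 : 3 <= l by case: lc.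
have eP i : e i \in edges (power m G) by apply: (subsetP FE); rewrite FI imset_f.
have [c [g [c_inj eE gE]]] := loose_cycle_power lc eP.
have n1 (i : 'I_l) : ordS i != i by apply: ordS_neq; apply: ltnW.
have n2 (i : 'I_l) : ordS (ordS i) != i by rewrite ordSS_neq.
have av i : c i != r -> c (ordS i) != r -> val (g i) \in edges_avoiding r.
  by move=> ci cSi; rewrite inE (valP (g i)) gE !inE negb_or ![r == _]eq_sym ci.
have step i : c i != r -> c (ordS i) != r -> c (ordS (ordS i)) = r.
  move=> ci cSi; apply/eqP/negPn/negP => cSSi.
  have := avoid_meet (av _ ci cSi) (av _ cSi cSSi).
  rewrite !gE => /(_ _)/setP/(_ (c i)).
  rewrite !inE eqxx !(inj_eq c_inj) ![i == _]eq_sym (negPf (n1 i)) (negPf (n2 i)).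
  suff ne : [set c i; c (ordS i)] :&: [set c (ordS i); c (ordS (ordS i))] != set0.
    by move/(_ ne).
  by apply/set0Pn; exists (c (ordS i)); rewrite !inE !eqxx orbT.
have [i0 ci0] : exists i, c i = r.
  pose i := Ordinal (leq_trans (isT : 0 < 3) l3).
  have [|ci] := eqVneq (c i) r; first by exists i.
  have [|cSi] := eqVneq (c (ordS i)) r; first by exists (ordS i).
  by exists (ordS (ordS i)); apply: step.
have cr i : i != i0 -> c i != r by rewrite -ci0 (inj_eq c_inj).
pose i1 := ordS i0; pose i2 := ordS i1.
have [ci1 ci2] : c i1 != r /\ c i2 != r by split; apply: cr; rewrite ?n1 ?n2.
have i3 : ordS i2 = i0 by apply: c_inj; rewrite ci0; apply: (step i1).
have lE : l = 3 := ordSSS_eq l3 i3.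
have cover (i : 'I_l) : [|| i == i0, i == i1 | i == i2].
  by rewrite /i2 /i1; move: (i0) (i); rewrite lE => j k; apply: ordS_cover3.
exists (val (g i1)); first exact: av.
rewrite FI; apply/setP => f; apply/imsetP/imsetP => [[i _ ->]|[d + ->]].
  exists (g i); last exact: eE.
  rewrite inE; case/or3P: (cover i) => /eqP->; rewrite ?eqxx // orbC.
    rewrite !gE ci0 !inE eqxx /= setU1K; last by rewrite inE eq_sym.
    by rewrite sub1set !inE eqxx.
  rewrite !gE i3 ci0 !inE eqxx orbT /= setUC setU1K; last by rewrite inE eq_sym.
  by rewrite sub1set !inE eqxx orbT.
rewrite inE => /orP[/eqP/val_inj->|/andP[rd]].
  by exists i1.
have [u nu dE] := edge_other G2 (valP d) rd.
rewrite dE setU1K ?inE // sub1set gE -/i2 !inE => /orP[]/eqP uE.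
  by exists i0 => //; rewrite eE; congr power_edge; apply: val_inj; rewrite dE gE ci0 uE.
exists i2 => //; rewrite eE; congr power_edge; apply: val_inj.
by rewrite dE gE i3 ci0 uE setUC.
Qed.

End Dominated.
End LooseCyclePower.

(** Isomorphisms carry loose cycles injectively to loose cycles. As a bound, this lets a two-element
    set containing all loose cycles contradict tricyclicity. *)
Lemma num_loose_cycles_iso_le (H1 H2 : hypergraph) (n : nat)
    (S : {set {set {set vertex H2}}}) :
  isomorphic H1 H2 -> num_loose_cycles H1 n ->
  (forall F, contains_loose_cycle (H := H2) F -> F \in S) -> n <= #|S|.
Proof.
move=> [f [fB fE]] [S1 [<- S1P]] SP.
have f_inj := bij_inj fB; have fs_inj := imset_inj f_inj.
rewrite -(card_imset S1 (imset_inj fs_inj)); apply: subset_leq_card.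
apply/subsetP => _ /imsetP[F /S1P[FE [l [v [e [[l3 v_inj ee ed] FI]]]]] ->].
apply: SP; split; first by rewrite fE; apply: imsetS.
exists l, (f \o v), (fun i => f @: e i); split.
  split=> //; first exact: inj_comp.
    by move=> i; rewrite -imsetI ?ee ?imset_set1 //; apply: in2W.
  move=> i j ij iS jS; rewrite -setI_eq0 -imsetI; last exact: in2W.
  by rewrite imset_eq0 setI_eq0 ed.
by rewrite FI -imset_comp; apply: eq_imset.
Qed.

Lemma connected_iso (H1 H2 : hypergraph) :
  isomorphic H1 H2 -> connected_hypergraph H1 -> connected_hypergraph H2.
Proof.
move=> [f [[g fK gK] fE]] H1c x y.
have /connectP[p gp gy] := H1c (g x) (g y).
rewrite -(gK x) -(gK y) gy; apply/connectP; exists (map f p); last by rewrite last_map.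
by rewrite path_map (eq_path (adjacent_iso (can_inj fK) fE)).
Qed.

Lemma connected_power (m : nat) (G : hypergraph) :
  connected_hypergraph (power m G) -> connected_hypergraph G.
Proof.
move=> Pc u w.
(* A new vertex counts as reached when an end of its edge is; this set is closed under adjacency in
   the power. *)
pose a (x : vertex (power m G)) := match x with
  | inl v => connect (@adjacent G) u v
  | inr (e, _) => [exists v in val e, connect (@adjacent G) u v] end.
have in_edge (e : {set vertex G}) v v' : e \in edges G -> v \in e -> v' \in e ->
    connect (@adjacent G) u v -> connect (@adjacent G) u v'.
  move=> eG ve v'e uv; have [<-//|nv] := eqVneq v v'.
  apply: connect_trans uv (connect1 _); rewrite /adjacent nv.
  by apply/existsP; exists e; rewrite eG ve.
have a_cl : closed (@adjacent (power m G)) a.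
  apply: intro_closed; first exact: sym_connect_sym (@adjacent_sym _).
  move=> x y /andP[_ /existsP[_ /and3P[/power_edgesP[e ->] xe ye]]] ax.
  have [v ve uv] : exists2 v, v \in val e & connect (@adjacent G) u v.
    case: x xe ax => [v|[d j]].
      by rewrite mem_power_edge_inl; exists v.
    by rewrite mem_power_edge_inr => /eqP-> /existsP[v /andP[]]; exists v.
  case: y ye => [v'|[d j]].
    by rewrite mem_power_edge_inl => v'e; apply: (in_edge _ _ _ (valP e) ve).
  by rewrite mem_power_edge_inr => /eqP->; apply/existsP; exists v; rewrite ve.
have := closed_connect a_cl (Pc (inl u) (inl w)).
by rewrite -!topredE /= connect0 => <-.
Qed.

(** * Graphs with two hubs *)

Section HubGraph.
Variables (V : finType) (Q : {set V}) (v1 v2 v3 v4 : V).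
Hypotheses (v_uniq : uniq [:: v1; v2; v3; v4]).
Hypothesis Q_v : [disjoint Q & [set v1; v2; v3; v4]].

Let v_neq : [/\ v1 != v2, v1 != v3, v1 != v4, v2 != v3 & v2 != v4].
Proof.
by move: v_uniq; rewrite /= !inE !negb_or -!andbA => /and5P[-> -> -> -> /and3P[->]].
Qed.

Let v1Q : v1 \notin [set v3; v4] :|: Q.
Proof.
have [_ n13 n14 _ _] := v_neq.
by rewrite !inE !negb_or n13 n14 (disjointFl Q_v) // !inE eqxx.
Qed.

Let v2Q : v2 \notin [set v3; v4] :|: Q.
Proof.
have [_ _ _ n23 n24] := v_neq.
by rewrite !inE !negb_or n23 n24 (disjointFl Q_v) // !inE eqxx orbT.
Qed.

Let pair_inj (u : V) (A : {set V}) : u \notin A -> {in A &, injective (fun w => [set u; w])}.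
Proof.
move=> uA w w' wA _ /setP/(_ w); rewrite !inE eqxx orbT => /esym/orP[]/eqP // wu.
by rewrite -wu wA in uA.
Qed.

(** The two families are disjoint, since no edge of the second contains [v1]. *)
Lemma sum_hub_edges (R : nmodType) (F : {set V} -> R) :
  (\sum_(e in hub_edges Q v1 v2 v3 v4) F e =
   \sum_(w in ~: (v1 |: Q)) F [set v1; w] + \sum_(w in [set v3; v4] :|: Q) F [set v2; w])%R.
Proof.
have v1n : v1 \notin ~: (v1 |: Q) by rewrite !inE eqxx.
rewrite -(big_imset F (pair_inj v1n)) -(big_imset F (pair_inj v2Q)).
rewrite -bigU /=; first by apply: eq_bigl => e; rewrite !inE.
rewrite disjoint_sym disjoint_subset; apply/subsetP => _ /imsetP[w wQ ->]; rewrite inE.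
apply/imsetP => -[w' _ /setP/(_ v1)]; rewrite !inE eqxx => /orP[] /eqP ve.
  by move: v_neq => -[]; rewrite ve eqxx.
by case/negP: v1Q; rewrite ve.
Qed.

Lemma card_hub_edges : #|hub_edges Q v1 v2 v3 v4| = #|V|.+1.
Proof.
have := sum_hub_edges (fun=> 1%N); rewrite !sum1_card => ->.
have v1nQ : v1 \notin Q by move: v1Q; rewrite inE negb_or => /andP[].
rewrite cardsCs setCK cardsU1 v1nQ cardsU cards2.
have n34 : v3 != v4.
  by move: v_uniq; rewrite /= !inE !negb_or => /and4P[_ _ ->].
rewrite n34 (_ : _ :&: Q = set0) ?cards0.
  have : #|v1 |: Q| <= #|V| by apply: max_card.
  rewrite cardsU1 v1nQ /=; lia.
apply/disjoint_setI0; rewrite disjoint_sym; apply: disjointWr Q_v.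
by apply/subsetP => u; rewrite !inE => /orP[]->; rewrite ?orbT.
Qed.

Lemma hub_edges_neq0 : set0 \notin hub_edges Q v1 v2 v3 v4.
Proof.
by apply/setUP => -[] /imsetP[w _ /setP]; [move/(_ v1) | move/(_ v2)]; rewrite !inE eqxx.
Qed.

(** Built on the same vertex set, so that a vector on [G] is a test vector here unchanged. *)
Definition hub_graph : hypergraph := Hypergraph hub_edges_neq0.

Lemma hub_graph_uniform : uniform 2 hub_graph.
Proof.
move=> e /setUP[] /imsetP[w wQ ->]; rewrite cards2.
  by move: wQ; rewrite !inE negb_or eq_sym => /andP[->].
by rewrite (contraNneq _ v2Q) // => ->.
Qed.

Lemma adjacent_hub1 (w : vertex hub_graph) :
  adjacent (v1 : vertex hub_graph) w = (w \notin v1 |: Q).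
Proof.
rewrite (adjacent_edge hub_graph_uniform) /=; apply/setUP/idP => [[]|wQ]; last first.
  by left; apply/imsetP; exists w; rewrite // inE.
  move=> /imsetP[w' w'Q /setP/(_ v1)]; rewrite !inE eqxx => /esym/orP[|] /eqP ve.
    by move: v_neq => -[]; rewrite ve eqxx.
  by case/negP: v1Q; rewrite ve.
move=> /imsetP[w' w'Q /setP ww]; move: (ww w) (ww w'); rewrite !inE !eqxx !orbT.
move=> /esym/orP[]/eqP wE; last by move: w'Q; rewrite wE !inE.
by move: w'Q; rewrite wE !inE => + /orP[]/eqP E; rewrite E eqxx.
Qed.

Lemma adjacent_hub2 (w : vertex hub_graph) :
  adjacent (v2 : vertex hub_graph) w = (w == v1) || (w \in [set v3; v4] :|: Q).
Proof.
have [wv1|wv1] := eqVneq w v1.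
  rewrite wv1 adjacent_sym adjacent_hub1 !inE negb_or eq_sym.
  have [-> _ _ _ _] := v_neq.
  by move: v2Q; rewrite inE negb_or => /andP[].
rewrite (adjacent_edge hub_graph_uniform) /=; apply/setUP/idP => [[]|wQ]; last first.
  by right; apply/imsetP; exists w.
  move=> /imsetP[w' w'Q /setP ww]; move: (ww w) (ww w'); rewrite !inE !eqxx !orbT.
  move=> /esym/orP[]/eqP wE; last by move: w'Q; rewrite wE !inE.
  move=> /orP[]/eqP w'E; last by move: w'Q; rewrite w'E !inE.
  by move: v2Q; rewrite -w'E w'Q.
move=> /imsetP[w' w'Q /setP/(_ v1)]; rewrite !inE eqxx /= ![v1 == _]eq_sym (negPf wv1).
by have [n12 _ _ _ _] := v_neq; rewrite eq_sym (negPf n12).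
Qed.

End HubGraph.

(** * Graphs with a vertex adjacent to all others *)

Section Dominating.
Variables (m : nat) (G : hypergraph) (r : vertex G).
Hypotheses (m_ge2 : 2 <= m) (G2 : uniform 2 G) (card_G : #|edges G| = #|vertex G|.+1).
Hypothesis r_dom : nonneighbours r = set0.

(** Exactly two edges avoid [r]. If they are disjoint, each loose cycle is one of two triangles; if
    they meet in [b], then [G] is the two-hub graph with hubs [r], [b] and empty [Q]. *)
Lemma dominating_iso_or_two_cycles :
  isomorphic (power m G) (T1C m (#|vertex G| - 4) 0 0 0) \/
  exists S : {set {set {set vertex (power m G)}}}, #|S| <= 2 /\
    forall F, contains_loose_cycle (H := power m G) F -> F \in S.
Proof.
have : #|edges_avoiding r| == 2 by rewrite card_edges_avoiding // r_dom cards0.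
move=> /cards2P[e1 [e2 [e12 eE]]].
have [e1E e2E] : e1 \in edges_avoiding r /\ e2 \in edges_avoiding r.
  by rewrite eE !inE !eqxx orbT.
have [dis|/set0Pn[b]] := eqVneq (e1 :&: e2) set0.
  right; exists [set triangle m r e1; triangle m r e2]; split.
    by rewrite cards2; case: (_ != _).
  move=> F /(loose_cycle_triangle G2 (r := r)) [].
    move=> e f; rewrite eE !inE => /orP[]/eqP-> /orP[]/eqP-> //; first by rewrite dis eqxx.
    by rewrite setIC dis eqxx.
  by move=> e; rewrite eE !inE => /orP[]/eqP-> ->; rewrite eqxx ?orbT.
rewrite inE => /andP[be1 be2]; left.
have eG e : e \in edges_avoiding r -> e \in edges G /\ r \notin e.
  by rewrite inE => /andP.
have [[e1G re1] [e2G re2]] := (eG _ e1E, eG _ e2E).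
have [a1 na1 e1P] := edge_other G2 e1G be1.
have [a2 na2 e2P] := edge_other G2 e2G be2.
have na12 : a1 != a2 by apply: contraNneq e12 => aE; rewrite e1P e2P aE.
have [rb ra1] : r != b /\ r != a1.
  by move: re1; rewrite e1P !inE negb_or => /andP.
have ra2 : r != a2 by move: re2; rewrite e2P !inE negb_or => /andP[].
have GE : edges G = hub_edges set0 r b a1 a2.
  have adj w : w != r -> adjacent r w.
    move=> wr; have : w \notin nonneighbours r by rewrite r_dom inE.
    by rewrite inE wr negbK.
  apply/setP => e; rewrite inE; have [re|re] := boolP (r \in e).
    rewrite [X in _ || X](_ : _ = false) ?orbF.
      apply/idP/imsetP => [eG'|[w wr ->]].
        have [w rw ->] := edge_other G2 eG' re; exists w => //.
        by rewrite !inE orbF eq_sym.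
      by rewrite -(adjacent_edge G2) adj //; move: wr; rewrite !inE orbF.
    apply/imsetP => -[w wa eP]; move: re; rewrite eP !inE (negPf rb) /=.
    by move: wa; rewrite !inE orbF => /orP[]/eqP-> ; rewrite ?(negPf ra1) ?(negPf ra2).
  rewrite [X in X || _](_ : _ = false) /=; last first.
    by apply/imsetP => -[w _ eP]; rewrite eP !inE eqxx in re.
  have -> : (e \in edges G) = (e \in edges_avoiding r) by rewrite inE re andbT.
  by rewrite eE setU0 imsetU1 imset_set1 -e1P -e2P.
have := @hub_power_iso m G set0 r b a1 a2 m_ge2 card_G _ _ GE.
rewrite cards0 subn0; apply; last by rewrite -setI_eq0 set0I.
by rewrite /= !inE !negb_or rb ra1 ra2 na1 na2 na12.
Qed.

End Dominating.


Local Open Scope ring_scope.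

(** * Extremal entries and the order of the graph *)

Lemma exists_max_outside (R : numDomainType) (V : finType) (x : V -> R) (s : seq V) :
  (forall v, x v \is Num.real) -> (size s < #|V|)%N ->
  exists2 v, v \notin s & forall u, u \notin s -> x u <= x v.
Proof.
move=> xr sV; have /existsP[v0 v0s] : [exists v, v \notin s].
  rewrite -[X in is_true X]negbK negb_exists; apply: contraL sV => /forallP sT.
  rewrite -leqNgt cardE; apply: uniq_leq_size (enum_uniq _) _ => v _.
  by have := sT v; rewrite negbK.
by case: (@real_arg_maxP _ _ v0 [pred v | v \notin s] x v0s (fun v _ => xr v)) => v; exists v.
Qed.

Lemma exists_min_outside (R : numDomainType) (V : finType) (x : V -> R) (s : seq V) :
  (forall v, x v \is Num.real) -> (size s < #|V|)%N ->
  exists2 v, v \notin s & forall u, u \notin s -> x v <= x u.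
Proof.
move=> xr /(exists_max_outside (x := fun v => - x v)) [v|v vs vM].
  by rewrite realN.
by exists v => // u /vM; rewrite lerN2.
Qed.

(** All degrees are at most [n - 2], so counting edge ends gives [2(n + 1) <= n(n - 2)], which fails
    for [n < 5]. *)
Lemma no_dominating_card (G : hypergraph) : uniform 2 G ->
  #|edges G| = #|vertex G|.+1 -> (forall r : vertex G, nonneighbours r != set0) ->
  (5 <= #|vertex G|)%N.
Proof.
move=> G2 card_G nd.
have sumE : (\sum_u \sum_(w : vertex G | adjacent u w) 1 = #|edges G| * 2)%N.
  transitivity (\sum_(e in edges G) \sum_(u in e) \sum_(w in e :\ u) 1)%N.
    exact: (sum_adjacent G2 (fun _ _ => 1%N)).
  rewrite -sum_nat_const; apply: eq_bigr => e /G2 e2.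
  rewrite -[RHS]e2 -[RHS]sum1_card; apply: eq_bigr => u ue.
  have := cardsD1 u e; rewrite e2 ue sum1_card /=; lia.
have deg (u : vertex G) : (\sum_(w | adjacent u w) 1 <= #|vertex G| - 2)%N.
  rewrite sum1_card; have /set0Pn[w] := nd u; rewrite inE => /andP[wu nuw].
  have : (#|[set u; w]| + #|[pred v | adjacent u v]| <= #|vertex G|)%N.
    rewrite -cardUI [X in (_ + X)%N]eq_card0 ?addn0 ?max_card // => v.
    rewrite !inE; case: (v =P u) => [->|_]; first by rewrite /adjacent eqxx andbF.
    by case: (v =P w) => [->|_] //; rewrite (negPf nuw) ?andbF.
  rewrite cards2 eq_sym wu /= => cV; rewrite leq_subRL; last by apply: leq_trans cV; rewrite leq_addr.
  exact: cV.
have : (\sum_(u : vertex G) \sum_(w | adjacent u w) 1 <= \sum_(u : vertex G) (#|vertex G| - 2))%N.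
  exact: leq_sum.
rewrite sumE card_G sum_nat_const; set n := #|_|; nia.
Qed.

(** * The comparison *)

(** Among the vertices of least entry, [q] is a non-neighbour of [v1] if possible; otherwise all
    non-neighbours have strictly larger entries. This alternative serves the equality case. *)
Lemma ordered_vertices (C : numClosedFieldType) (G : hypergraph) (x : vertex G -> C) :
  (forall v, 0 < x v) -> (5 <= #|vertex G|)%N ->
  exists v1 v2 v3 v4 q : vertex G,
    [/\ uniq [:: v1; v2; v3; v4; q], forall v, x v <= x v1, forall v, x q <= x v
      & ~~ adjacent v1 q \/ (forall w, w != v1 -> ~~ adjacent v1 w -> x q < x w)] /\
    [/\ forall v, v != v1 -> x v <= x v2,
        forall v, v != v1 -> v != v2 -> x v <= x v3
      & forall v, v != v1 -> v != v2 -> v != v3 -> x v <= x v4].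
Proof.
move=> x0 n5; have xr v : x v \is Num.real by rewrite ger0_real ?ltW.
have outside s : (size s < 5)%N -> exists2 v, v \notin s & forall u, u \notin s -> x u <= x v.
  by move=> s5; apply: exists_max_outside => //; apply: leq_trans s5 n5.
have [v1 _ v1M] := outside [::] isT; have {}v1M v := v1M v isT.
have [q [q1 qm qW]] : exists q, [/\ q != v1, forall v, x q <= x v
    & ~~ adjacent v1 q \/ (forall w, w != v1 -> ~~ adjacent v1 w -> x q < x w)].
  have [/existsP[q /andP[]]|none] :=
    boolP [exists q, (q \in nonneighbours v1) && [forall v, x q <= x v]].
    by rewrite inE => /andP[q1 nq] /forallP qm; exists q; split=> //; left.
  have [q qs qm] := exists_min_outside xr (s := [:: v1]) (leq_trans (isT : (1 < 5)%N) n5).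
  have {}qm v : x q <= x v.
    have [->|vv1] := eqVneq v v1; first exact: v1M.
    by apply: qm; rewrite inE.
  exists q; split=> //; first by rewrite inE in qs.
  right=> w w1 nw; rewrite lt_def qm andbT; apply: contraNneq none => xwq.
  by apply/existsP; exists w; rewrite inE w1 nw; apply/forallP => v; rewrite xwq.
(* [q] is excluded from these choices; since its entry is minimal, the maximality bounds extend to
   it. *)
have [v2 v2s v2M] := outside [:: v1; q] isT.
have [v3 v3s v3M] := outside [:: v1; q; v2] isT.
have [v4 v4s v4M] := outside [:: v1; q; v2; v3] isT.
exists v1, v2, v3, v4, q; split; split=> //.
- move: v2s v3s v4s q1; rewrite /= !inE !negb_or ![v1 == _]eq_sym.
  move=> /andP[-> n2q] /and3P[-> n3q n32] /and4P[-> n4q n42 n43] ->.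
  by rewrite n2q n3q n4q ![v2 == _]eq_sym n32 n42 [v3 == v4]eq_sym n43.
- move=> v nv1; have [->//|vq] := eqVneq v q.
  by apply: v2M; rewrite !inE negb_or nv1.
- move=> v nv1 nv2; have [->//|vq] := eqVneq v q.
  by apply: v3M; rewrite !inE !negb_or nv1 vq.
- move=> v nv1 nv2 nv3; have [->//|vq] := eqVneq v q.
  by apply: v4M; rewrite !inE !negb_or nv1 vq nv2.
Qed.

Lemma power_lambda1_le (C : numClosedFieldType) (m : nat) (G : hypergraph) :
  (2 <= m)%N -> uniform 2 G -> #|edges G| = #|vertex G|.+1 ->
  connected_hypergraph (power m G) -> (forall r : vertex G, nonneighbours r != set0) ->
  let T := T1C m (#|vertex G| - 4 - 1) 0 1 0 in
  lambda1 C m (power m G) <= lambda1 C m T /\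
  (lambda1 C m (power m G) = lambda1 C m T -> isomorphic (power m G) T).
Proof.
move=> m2 G2 card_G Pc nd T.
have n5 := no_dominating_card G2 card_G nd.
have E0 : edges G != set0 by rewrite -card_gt0 card_G.
have [] := power_perron C m2 G2 Pc E0.
set mu := scaled_lambda1 C m _; set kappa := mu + 1 - _; set c := _ / kappa.
move=> k0 [x x0 xE].
have c0 : 0 <= c by rewrite divr_ge0 ?ler0n ?ltW.
have [v1 [v2 [v3 [v4 [q [[v_uniq x1 xq q_choice] [x2 x3 x4]]]]]]] := ordered_vertices x0 n5.
have [w0 w0N] := set0Pn _ (nd v1).
have /andP[w01 w0n] : (w0 != v1) && ~~ adjacent v1 w0 by rewrite inE in w0N.
have v4_uniq : uniq [:: v1; v2; v3; v4].
  by move: v_uniq; rewrite -[[:: v1, _ & _]]/([:: v1; v2; v3; v4] ++ [:: q]) cat_uniq => /andP[].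
have disj u3 u4 : uniq [:: v1; v2; u3; u4; q] -> [disjoint [set q] & [set v1; v2; u3; u4]].
  rewrite -[[:: v1, _ & _]]/([:: v1; v2; u3; u4] ++ [:: q]) cat_uniq => /and3P[_ + _].
  by rewrite /= orbF disjoints1 !inE -!orbA.
have card_q : #|[set q]| = 1%N by rewrite cards1.
have qv := disj _ _ v_uniq.
pose Gam := hub_graph [set q] v1 v2 v3 v4.
have Gam2 : uniform 2 Gam := hub_graph_uniform v4_uniq qv.
have Gam_iso : isomorphic (power m Gam) T.
  have := @hub_power_iso m Gam [set q] v1 v2 v3 v4 m2 (card_hub_edges v4_uniq qv) v4_uniq qv erefl.
  by rewrite card_q.
have G_conn v : connect (@adjacent G) v1 v := connected_power Pc v1 v.
have le_hub := shift_le G2 c0 card_G G_conn v_uniq x0 x1 x2 x3 x4 xq w01 w0n.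
have [n12 n13 n14 n23 n24] : [/\ v1 != v2, v1 != v3, v1 != v4, v2 != v3 & v2 != v4].
  by move: v4_uniq; rewrite /= !inE !negb_or -!andbA => /and5P[-> -> -> -> /and3P[->]].
have [n1q n2q n3q n4q n34] : [/\ v1 != q, v2 != q, v3 != q, v4 != q & v3 != v4].
  move: v_uniq; rewrite /= !inE !negb_or -!andbA.
  by case/and5P=> _ _ _ -> /and5P[_ _ -> -> /and3P[-> -> _]].
have sum_hub3 (F : vertex G -> C) :
    \sum_(w in [set v3; v4] :|: [set q]) F w = F v3 + F v4 + F q.
  rewrite setUC big_setU1 ?big_setU1 ?big_set1 /= ?inE //; first by rewrite addrC.
  by rewrite negb_or [q == v3]eq_sym n3q eq_sym.
(* Both sides become total edge weights, with [mu] and [c] still those of [G], and [shift_le]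
   compares them. *)
have form_le : mu * \sum_u x u ^+ 2 <= \sum_u x u * twisted_row (G := Gam) c x u.
  have -> : mu * \sum_u x u ^+ 2 = \sum_u x u * twisted_row c x u.
    by rewrite mulr_sumr; apply: eq_bigr => u _; rewrite xE expr2 mulrCA.
  rewrite (sum_twisted_row c x G2) (sum_twisted_row (G := Gam) c x Gam2).
  apply: le_trans le_hub _; rewrite (sum_hub_edges v4_uniq qv) sum_hub3.
  rewrite lerD //.
    apply: ler_sum => w; rewrite !inE negb_or eq_sym => /andP[w1 _].
    by rewrite set_weight2.
  by rewrite !set_weight2.
have [u||le_mu eq_mu] := power_rayleigh m2 Gam2 k0 _ _ form_le.
- exact: ltW.
- by exists v1.
have m1 : 0 < (m - 1)%:R :> C by rewrite ltr0n subn_gt0.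
have lamT : lambda1 C m T = lambda1 C m (power m Gam).
  apply/esym/lambda1_iso => //; apply/card_gt0P; by exists (inl v1).
rewrite lamT; split; first by rewrite -(ler_pM2l m1).
move=> lamE; have muE : mu = scaled_lambda1 C m (power m Gam).
  by rewrite /mu /scaled_lambda1 lamE.
have rowE := eq_mu muE.
(* In the equality case the twisted rows of [G] and [Gam] both equal [mu * x], so they agree at the
   hubs. *)
have row1 : twisted_row c x v1 = \sum_(w in ~: [set v1; q]) half_weight c (x v1) (x w).
  rewrite xE -rowE; apply: eq_bigl => w.
  by rewrite (adjacent_hub1 v4_uniq qv) !inE.
have row2 : twisted_row c x v2 = half_weight c (x v2) (x v1) + half_weight c (x v2) (x v3) +
    half_weight c (x v2) (x v4) + half_weight c (x v2) (x q).
  transitivity (half_weight c (x v2) (x v1) +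
    (half_weight c (x v2) (x v3) + half_weight c (x v2) (x v4) + half_weight c (x v2) (x q))).
    rewrite xE -rowE -(sum_hub3 (fun w => half_weight c (x v2) (x w))).
    rewrite /twisted_row (bigD1 (v1 : vertex Gam)) /=; last first.
      by rewrite (adjacent_hub2 v4_uniq qv) eqxx.
    congr (_ + _); apply: eq_bigl => w; rewrite (adjacent_hub2 v4_uniq qv).
    have [->|] := eqVneq w v1; last by rewrite andbT.
    by rewrite !inE (negPf n13) (negPf n14) (negPf n1q).
  by rewrite 2!(addrA (half_weight c (x v2) (x v1))).
have [u3 [u4 [u_uniq GE]]] := shift_eq G2 c0 card_G G_conn v_uniq x0 x3 x4 w01 w0n q_choice row1 row2.
have u4_uniq : uniq [:: v1; v2; u3; u4].
  by move: u_uniq; rewrite -[[:: v1, _ & _]]/([:: v1; v2; u3; u4] ++ [:: q]) cat_uniq => /andP[].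
have := hub_power_iso m2 card_G u4_uniq (disj _ _ u_uniq) GE.
by rewrite card_q.
Qed.

Theorem theorem5p1p2 (C : numClosedFieldType) (m k : nat) (H : hypergraph)
    (m_ge2 : (2 <= m)%N)
    (H_power : is_power_hypergraph m H)
    (H_uniform : uniform m H)
    (H_linear : linear_hypergraph H)
    (H_connected : connected_hypergraph H)
    (H_tricyclic : tricyclic H)
    (H_typeI : typeI m H)
    (H_edges : #|edges H| = k)
    (H_neq : ~ isomorphic H (T1C m (k - 5) 0 0 0)) :
  lambda1 C m H <= lambda1 C m (T1C m (k - 6) 0 1 0) /\
  (lambda1 C m H = lambda1 C m (T1C m (k - 6) 0 1 0) ->
   isomorphic H (T1C m (k - 6) 0 1 0)).
Proof.
have [G [G2 HP]] := H_power.
have [cV cE] := card_iso HP.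
(* With [n] vertices in [G], Type I reads [n + k(m - 2) + 1 = k(m - 1)], that is, [k = n + 1]. *)
have card_G : #|edges G| = #|vertex G|.+1.
  have := H_typeI; rewrite /typeI cV cE card_power_vertices card_power_edges.
  have -> : (m - 1 = (m - 2).+1)%N by lia.
  by rewrite mulnS; lia.
have kE : k = #|vertex G|.+1 by rewrite -H_edges cE card_power_edges card_G.
have Pc := connected_iso HP H_connected.
(* A vertex adjacent to all others would yield the excluded hypergraph or at most two loose
   cycles. *)
have nd (r : vertex G) : nonneighbours r != set0.
  apply/eqP => r_dom.
  have [PT|[S [S2 SP]]] := dominating_iso_or_two_cycles m_ge2 G2 card_G r_dom.
    apply: H_neq; rewrite kE subSS; exact: isomorphic_trans HP PT.
  by have := leq_trans (num_loose_cycles_iso_le HP H_tricyclic SP) S2.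
have H0 : (0 < #|vertex H|)%N.
  have : #|edges H| != 0%N by rewrite cE card_power_edges card_G.
  rewrite cards_eq0 => /set0Pn[e eH]; have /set0Pn[v _] : e != set0.
    by apply: contraNneq (edges_neq0 H) => <-.
  by apply/card_gt0P; exists v.
have -> : (k - 6 = #|vertex G| - 4 - 1)%N by rewrite kE; lia.
rewrite (lambda1_iso C m_ge2 H0 HP).
have [le_T eq_T] := power_lambda1_le C m_ge2 G2 card_G Pc nd.
by split=> // /eq_T; apply: isomorphic_trans.
Qed.
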